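(* Let $k$ be a field, let $\mathfrak{h}$ be a finite dimensional Leibniz algebra over $k$ with basis $\{e_1,\dots,e_n\}$, and let $U\bigl(G(\mathcal{A}(\mathfrak{h})^{\mathrm{o}})\bigr)$ be the group of all invertible group-like elements of the finite dual $\mathcal{A}(\mathfrak{h})^{\mathrm{o}}$. Then the map $$\overline{\gamma}: U\bigl(G(\mathcal{A}(\mathfrak{h})^{\mathrm{o}})\bigr)\to\mathrm{Aut}_{\mathrm{Lbz}}(\mathfrak{h}),\qquad \overline{\gamma}(\theta)(e_i):=\sum_{s=1}^n\theta(x_{si})\,e_s,$$ defined for all $\theta\in U\bigl(G(\mathcal{A}(\mathfrak{h})^{\mathrm{o}})\bigr)$ and $i=1,\dots,n$, is an isomorphism of groups.
   Context: All vector spaces, algebras and tensor products are over an arbitrary field $k$; algebras are unital and algebra homomorphisms preserve units. A Leibniz algebra is a vector space $\mathfrak{h}$ with a bilinear map $[-,-]$ satisfying $[x,[y,z]] = [[x,y],z]-[[x,z],y]$ for all $x,y,z$; homomorphisms are bracket-preserving linear maps, and $\mathrm{Aut}_{\mathrm{Lbz}}(\mathfrak{h})$ is the group (under composition) of Leibniz algebra automorphisms of $\mathfrak{h}$. Universal bialgebra $\mathcal{A}(\mathfrak{h})$: for the basis $\{e_1,\dots,e_n\}$ of $\mathfrak{h}$, with structure constants $[e_i,e_j]=\sum_{s=1}^n\tau_{i,j}^s e_s$, $\mathcal{A}(\mathfrak{h}):=k[X_{ij}\mid i,j=1,\dots,n]/J$, where $J$ is the ideal generated by the polynomials $$\sum_{u=1}^n\tau_{i,j}^u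 X_{au}-\sum_{s,t=1}^n\tau_{s,t}^a X_{si}X_{tj},\qquad a,i,j=1,\dots,n.$$ Write $x_{ij}$ for the class of $X_{ij}$. $\mathcal{A}(\mathfrak{h})$ is a commutative bialgebra with $\Delta(x_{ij})=\sum_{s=1}^n x_{is}\otimes x_{sj}$ and $\varepsilon(x_{ij})=\delta_{i,j}$. For a bialgebra $H$, $G(H):=\{g\in H\mid\Delta(g)=g\otimes g,\ \varepsilon(g)=1\}$ is the monoid of group-like elements under the multiplication of $H$, and $U(-)$ denotes the group of invertible elements of a monoid. The finite dual bialgebra is $H^{\mathrm{o}}:=\{f\in H^*\mid f(I)=0\text{ for some ideal } I\text{ of } H\text{ with }\dim_k(H/I)<\infty\}$, whose multiplication is convolution and whose unit is $\varepsilon_H$. It is well known that $G(H^{\mathrm{o}})=\mathrm{Hom}_{\mathrm{Alg}_k}(H,k)$, the set of algebra homomorphisms $H\to k$. *)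

(* Defs.v *)
From HB Require Import structures.
From mathcomp Require Import all_boot all_algebra.
From mathcomp Require Import boolp classical_sets.
From mathcomp.multinomials Require Import mpoly.
From mathcomp Require Import generic_quotient ring_quotient.

Set Implicit Arguments.
Unset Strict Implicit.
Unset Printing Implicit Defensive.

Import GRing.Theory.

Local Open Scope ring_scope.
Local Open Scope quotient_scope.

Section LinearFacts.
Variables (k : fieldType) (U V : lmodType k) (f : U -> V).
Hypothesis fP : linear f.
Lemma linfD x y : f (x + y) = f x + f y.
Proof. by have := fP 1 x y; rewrite !scale1r. Qed.
Lemma linf0 : f 0 = 0.
Proof. by apply: (addIr (f 0)); rewrite -linfD !add0r. Qed.
Lemma linfZ a x : f (a *: x) = a *: f x.
Proof. by have := fP a x 0; rewrite !addr0 linf0 addr0. Qed.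
Lemma linf_sum I (r : seq I) (P : pred I) F :
  f (\sum_(i <- r | P i) F i) = \sum_(i <- r | P i) f (F i).
Proof. by elim/big_rec2: _ => [|i x y _ <-]; rewrite ?linf0 ?linfD. Qed.
End LinearFacts.

Section Bilinear.
Variables (k : fieldType) (U V W : lmodType k).

Definition bilin (b : U -> V -> W) : Prop :=
  (forall v, linear (b^~ v)) /\ (forall u, linear (b u)).

Variable b : U -> V -> W.
Hypothesis bP : bilin b.

Lemma bilinDl u u' v : b (u + u') v = b u v + b u' v.
Proof. by have := bP.1 v 1 u u'; rewrite !scale1r. Qed.
Lemma bilinDr u v v' : b u (v + v') = b u v + b u v'.
Proof. by have := bP.2 u 1 v v'; rewrite !scale1r. Qed.
Lemma bilin0l v : b 0 v = 0.
Proof. by apply: (addIr (b 0 v)); rewrite -bilinDl !add0r. Qed.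
Lemma bilin0r u : b u 0 = 0.
Proof. by apply: (addIr (b u 0)); rewrite -bilinDr !add0r. Qed.
Lemma bilinZl a u v : b (a *: u) v = a *: b u v.
Proof. by have := bP.1 v a u 0; rewrite !addr0 bilin0l addr0. Qed.
Lemma bilinZr a u v : b u (a *: v) = a *: b u v.
Proof. by have := bP.2 u a v 0; rewrite !addr0 bilin0r addr0. Qed.
Lemma bilin_suml I (r : seq I) (P : pred I) F v :
  b (\sum_(i <- r | P i) F i) v = \sum_(i <- r | P i) b (F i) v.
Proof. by elim/big_rec2: _ => [|i x y _ <-]; rewrite ?bilin0l ?bilinDl. Qed.
Lemma bilin_sumr I (r : seq I) (P : pred I) F u :
  b u (\sum_(i <- r | P i) F i) = \sum_(i <- r | P i) b u (F i).
Proof. by elim/big_rec2: _ => [|i x y _ <-]; rewrite ?bilin0r ?bilinDr. Qed.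
End Bilinear.

(* The tensor product: formal sums of pairs (u, v), where two formal sums are
   identified when every bilinear map (into any vector space) gives them the
   same value. Its universal property is given by ptensor_bilin,
   tensor_lift_linear, tensor_liftE and linear_tensor_ext. *)
Section Tensor.
Variables (k : fieldType) (U V : lmodType k).

Definition fsum_val (W : lmodType k) (b : U -> V -> W) (s : seq (U * V)) : W :=
  \sum_(p <- s) b p.1 p.2.

Definition tensor_equiv (s t : seq (U * V)) : bool :=
  `[< forall (W : lmodType k) (b : U -> V -> W),
        bilin b -> fsum_val b s = fsum_val b t >].

Lemma tensor_equivP s t :
  (forall (W : lmodType k) (b : U -> V -> W),
     bilin b -> fsum_val b s = fsum_val b t) <-> tensor_equiv s t.
Proof. by split=> [?|/asboolP]; first exact/asboolP. Qed.

Lemma tensor_equiv_is_equiv : equiv_class_of tensor_equiv.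
Proof.
split=> [s|s t|t s r].
- exact/tensor_equivP.
- by apply/idP/idP=> /tensor_equivP h; apply/tensor_equivP=> W b hb; rewrite h.
- move=> /tensor_equivP h1 /tensor_equivP h2; apply/tensor_equivP=> W b hb.
  by rewrite h1 // h2.
Qed.
Canonical tensor_equiv_equiv := EquivRelPack tensor_equiv_is_equiv.
Canonical tensor_encModRel := defaultEncModRel tensor_equiv.

Definition tensor := {eq_quot tensor_equiv}.
HB.instance Definition _ := Choice.on tensor.

Definition mk_tensor (s : seq (U * V)) : tensor := \pi_({eq_quot tensor_equiv}) s.
Definition ptensor (u : U) (v : V) : tensor := mk_tensor [:: (u, v)].

Lemma mk_tensorK (t : tensor) : mk_tensor (repr (t : {eq_quot tensor_equiv})) = t.
Proof. exact: reprK. Qed.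

Lemma mk_tensorP s t : mk_tensor s = mk_tensor t <->
  forall (W : lmodType k) (b : U -> V -> W),
    bilin b -> fsum_val b s = fsum_val b t.
Proof.
rewrite tensor_equivP; split.
  by move/eqP; rewrite eqmodE.
by move=> h; apply/eqP; rewrite eqmodE.
Qed.

Definition tensor_lift (W : lmodType k) (b : U -> V -> W) (t : tensor) : W :=
  fsum_val b (repr (t : {eq_quot tensor_equiv})).

Lemma tensor_lift_mk (W : lmodType k) (b : U -> V -> W) s :
  bilin b -> tensor_lift b (mk_tensor s) = fsum_val b s.
Proof.
move=> hb; rewrite /tensor_lift.
by apply: (mk_tensorP _ _).1; rewrite // mk_tensorK.
Qed.

Lemma tensor_eq (t t' : tensor) :
  (forall (W : lmodType k) (b : U -> V -> W),
    bilin b -> tensor_lift b t = tensor_lift b t') -> t = t'.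
Proof.
by move=> h; rewrite -[t]mk_tensorK -[t']mk_tensorK; apply/mk_tensorP=> W b /h.
Qed.

Definition fsum_scale (a : k) (s : seq (U * V)) := [seq (a *: p.1, p.2) | p <- s].

Lemma fsum_val_cat (W : lmodType k) (b : U -> V -> W) s t :
  fsum_val b (s ++ t) = fsum_val b s + fsum_val b t.
Proof. by rewrite /fsum_val big_cat. Qed.

Lemma fsum_val_scale (W : lmodType k) (b : U -> V -> W) a s :
  bilin b -> fsum_val b (fsum_scale a s) = a *: fsum_val b s.
Proof.
move=> hb; rewrite /fsum_val big_map scaler_sumr.
by apply: eq_bigr => p _; rewrite (bilinZl hb).
Qed.

Definition tensor_zero : tensor := mk_tensor [::].
Definition tensor_add (t t' : tensor) : tensor :=
  mk_tensor (repr (t : {eq_quot tensor_equiv})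
             ++ repr (t' : {eq_quot tensor_equiv})).
Definition tensor_scale (a : k) (t : tensor) : tensor :=
  mk_tensor (fsum_scale a (repr (t : {eq_quot tensor_equiv}))).
Definition tensor_opp (t : tensor) : tensor := tensor_scale (-1) t.

Section Lift.
Variables (W : lmodType k) (b : U -> V -> W).
Hypothesis hb : bilin b.
Lemma tensor_lift0 : tensor_lift b tensor_zero = 0.
Proof. by rewrite tensor_lift_mk // /fsum_val big_nil. Qed.
Lemma tensor_liftD t t' :
  tensor_lift b (tensor_add t t') = tensor_lift b t + tensor_lift b t'.
Proof. by rewrite tensor_lift_mk // fsum_val_cat. Qed.
Lemma tensor_liftZ a t :
  tensor_lift b (tensor_scale a t) = a *: tensor_lift b t.
Proof. by rewrite tensor_lift_mk // fsum_val_scale. Qed.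
End Lift.

Lemma tensor_addA : associative tensor_add.
Proof. by move=> x y z; apply: tensor_eq => W b hb; rewrite !tensor_liftD // addrA. Qed.
Lemma tensor_addC : commutative tensor_add.
Proof. by move=> x y; apply: tensor_eq => W b hb; rewrite !tensor_liftD // addrC. Qed.
Lemma tensor_add0 : left_id tensor_zero tensor_add.
Proof.
by move=> x; apply: tensor_eq => W b hb; rewrite tensor_liftD // tensor_lift0 // add0r.
Qed.
Lemma tensor_addN : left_inverse tensor_zero tensor_opp tensor_add.
Proof.
move=> x; apply: tensor_eq => W b hb.
by rewrite tensor_liftD // tensor_liftZ // tensor_lift0 // scaleN1r addNr.
Qed.
HB.instance Definition _ :=
  GRing.isZmodule.Build tensor tensor_addA tensor_addC tensor_add0 tensor_addN.

Lemma tensor_scaleA a c t :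
  tensor_scale a (tensor_scale c t) = tensor_scale (a * c) t.
Proof. by apply: tensor_eq => W b hb; rewrite !tensor_liftZ // scalerA. Qed.
Lemma tensor_scale1 : left_id 1 tensor_scale.
Proof. by move=> t; apply: tensor_eq => W b hb; rewrite tensor_liftZ // scale1r. Qed.
Lemma tensor_scaleDr : right_distributive tensor_scale +%R.
Proof.
move=> a x y; apply: tensor_eq => W b hb.
by rewrite ?(tensor_liftZ, tensor_liftD) // scalerDr.
Qed.
Lemma tensor_scaleDl t : {morph tensor_scale^~ t : a c / a + c}.
Proof.
move=> a c; apply: tensor_eq => W b hb.
by rewrite ?(tensor_liftZ, tensor_liftD) // scalerDl.
Qed.
HB.instance Definition _ := GRing.Zmodule_isLmodule.Build k tensor
  tensor_scaleA tensor_scale1 tensor_scaleDr tensor_scaleDl.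

Lemma tensor_lift_linear (W : lmodType k) (b : U -> V -> W) :
  bilin b -> linear (tensor_lift b).
Proof. by move=> hb a x y; rewrite tensor_liftD // tensor_liftZ. Qed.

Lemma tensor_liftE (W : lmodType k) (b : U -> V -> W) u v :
  bilin b -> tensor_lift b (ptensor u v) = b u v.
Proof. by move=> hb; rewrite tensor_lift_mk // /fsum_val big_seq1. Qed.

Lemma ptensor_bilin : bilin ptensor.
Proof.
split=> [v a u u'|u a v v']; apply: tensor_eq => W b hb.
  by rewrite tensor_lift_linear // !tensor_liftE // hb.1.
by rewrite tensor_lift_linear // !tensor_liftE // hb.2.
Qed.

Lemma mk_tensorE s : mk_tensor s = fsum_val ptensor s.
Proof.
apply: tensor_eq => W b hb; rewrite tensor_lift_mk // /fsum_val.
elim: s => [|p s IH]; first by rewrite !big_nil (tensor_lift0 hb).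
by rewrite !big_cons (tensor_liftD hb) IH tensor_liftE.
Qed.

Lemma tensor_sum (t : tensor) : exists s : seq (U * V),
  t = \sum_(p <- s) ptensor p.1 p.2.
Proof. by exists (repr (t : {eq_quot tensor_equiv})); rewrite -[LHS]mk_tensorK mk_tensorE. Qed.

Lemma tensor_ind (P : tensor -> Prop) :
  P 0 -> (forall t u v, P t -> P (ptensor u v + t)) -> forall t, P t.
Proof.
move=> P0 PD t; have [s ->] := tensor_sum t.
by elim: s => [|p s IH]; rewrite ?big_nil // big_cons; apply: PD.
Qed.

Lemma linear_tensor_ext (W : lmodType k) (f g : tensor -> W) :
  linear f -> linear g -> (forall u v, f (ptensor u v) = g (ptensor u v)) ->
  f =1 g.
Proof.
move=> lf lg h; elim/tensor_ind => [|t u v IH].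
  have := lf (-1) 0 0; have := lg (-1) 0 0.
  by rewrite scaleN1r !addNr !scaleN1r !addNr => -> ->.
have := lf 1 (ptensor u v) t; have := lg 1 (ptensor u v) t.
by rewrite !scale1r => -> ->; rewrite IH h.
Qed.

End Tensor.

Notation "u ⊗ v" := (ptensor u v) (at level 40, left associativity) : ring_scope.


Section TensorFunctor.
Variable k : fieldType.

Lemma bilin_precomp (U V W : lmodType k) (b : U -> V -> W) (U' V' : lmodType k)
    (f : U' -> U) (g : V' -> V) :
  bilin b -> linear f -> linear g -> bilin (fun u v => b (f u) (g v)).
Proof.
move=> hb lf lg; split=> [v a x y|u a x y].
  by rewrite lf hb.1.
by rewrite lg hb.2.
Qed.

Definition tensor_map (U V U' V' : lmodType k) (f : U -> U') (g : V -> V') :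
    tensor U V -> tensor U' V' :=
  tensor_lift (fun u v => f u ⊗ g v).

Lemma tensor_map_bilin (U V U' V' : lmodType k) (f : U -> U') (g : V -> V') :
  linear f -> linear g -> bilin (fun u v => f u ⊗ g v).
Proof. exact/bilin_precomp/ptensor_bilin. Qed.

Lemma tensor_mapE (U V U' V' : lmodType k) (f : U -> U') (g : V -> V') u v :
  linear f -> linear g -> tensor_map f g (u ⊗ v) = f u ⊗ g v.
Proof. by move=> lf lg; rewrite /tensor_map tensor_liftE //; apply: tensor_map_bilin. Qed.

Lemma tensor_map_linear (U V U' V' : lmodType k) (f : U -> U') (g : V -> V') :
  linear f -> linear g -> linear (tensor_map f g).
Proof. by move=> lf lg; apply/tensor_lift_linear/tensor_map_bilin. Qed.

Lemma tensor_lift_map (U V U' V' W : lmodType k) (f : U -> U') (g : V -> V')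
    (b : U' -> V' -> W) t : linear f -> linear g -> bilin b ->
  tensor_lift b (tensor_map f g t) = tensor_lift (fun u v => b (f u) (g v)) t.
Proof.
move=> lf lg hb.
have hb' := bilin_precomp hb lf lg.
apply: (linear_tensor_ext (f := fun t => tensor_lift b (tensor_map f g t))).
- by move=> a x y; rewrite tensor_map_linear // tensor_lift_linear.
- exact: tensor_lift_linear.
- by move=> u v; rewrite tensor_mapE // !tensor_liftE.
Qed.

Definition tensor_assoc (U V W : lmodType k) :
    tensor (tensor U V) W -> tensor U (tensor V W) :=
  tensor_lift (fun t w => tensor_lift (fun u v => u ⊗ (v ⊗ w)) t).

Section Assoc.
Variables (U V W : lmodType k).

Lemma assoc_bilin1 (w : W) : bilin (fun (u : U) (v : V) => u ⊗ (v ⊗ w)).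
Proof.
split=> [v|u] a x y; first exact: (ptensor_bilin _ _).1.
by rewrite (ptensor_bilin _ _).1 (ptensor_bilin _ _).2.
Qed.

Lemma assoc_bilin : bilin (fun (t : tensor U V) (w : W) =>
  tensor_lift (fun u v => u ⊗ (v ⊗ w)) t).
Proof.
split=> [w|t a w w']; first exact/tensor_lift_linear/assoc_bilin1.
pose F (w : W) := tensor_lift (fun (u : U) (v : V) => u ⊗ (v ⊗ w)).
have FL w0 : linear (F w0) by apply/tensor_lift_linear/assoc_bilin1.
apply: (linear_tensor_ext (f := F (a *: w + w'))
  (g := fun t => a *: F w t + F w' t)) => //.
  move=> c x y; rewrite !FL !scalerDr !scalerA mulrC -!addrA; congr (_ + _).
  by rewrite addrCA.
move=> u v; rewrite /F !tensor_liftE; try exact: assoc_bilin1.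
by rewrite (ptensor_bilin _ _).2 (ptensor_bilin _ _).2.
Qed.

Lemma tensor_assoc_linear : linear (@tensor_assoc U V W).
Proof. exact/tensor_lift_linear/assoc_bilin. Qed.

Lemma tensor_assocE (u : U) (v : V) (w : W) :
  tensor_assoc (u ⊗ v ⊗ w) = u ⊗ (v ⊗ w).
Proof.
rewrite /tensor_assoc tensor_liftE ?tensor_liftE //; last exact: assoc_bilin.
exact: assoc_bilin1.
Qed.
End Assoc.

End TensorFunctor.

(* Over a field, linear functionals separate points; needed to know that the
   tensor product of two nonzero algebras is nonzero. *)
Lemma linear_form_neq0 (k : fieldType) (V : lmodType k) (v : V) :
  v != 0 -> exists f : V -> k^o, linear f /\ f v != 0.
Proof.
move=> v0.
pose P (A : set V) := ~ A v /\
  forall (a : k) x y, A x -> A y -> A (a *: x + y).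
have [F FP Ftot|A [[Av Alin] Amax]] := @Zorn_bigcup V P.
  split; first by case=> X /FP [].
  move=> a x y [X FX Xx] [Y FY Yy].
  have [XY|YX] := Ftot _ _ FX FY.
    by exists Y => //; apply: (FP _ FY).2 => //; apply: XY.
  by exists X => //; apply: (FP _ FX).2 => //; apply: YX.
have A0 : A 0.
  apply: contrapT => nA0; apply: (Amax (fun x => x = 0 \/ A x)).
    by split; [move=> x; right|move=> e; apply: nA0; apply: e; left].
  have A_ x : ~ A x.
    by move=> Ax; apply: nA0; have := Alin (-1) x x Ax Ax; rewrite scaleN1r addNr.
  split; first by case=> [/eqP|]; [rewrite (negPf v0)|].
  move=> a x y [->|/A_ //] [->|/A_ //]; left.
  by rewrite scaler0 addr0.
have AZ a x : A x -> A (a *: x).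
  by move=> Ax; rewrite -[_ *: _]addr0; apply: Alin.
have AD x y : A x -> A y -> A (x + y).
  by move=> Ax Ay; rewrite -[x]scale1r; apply: Alin.
have AB x y : A x -> A y -> A (x - y).
  by move=> Ax Ay; rewrite addrC -scaleN1r; apply: Alin.
have dec x : exists c : k, A (x - c *: v).
  apply: contrapT => nx.
  have nAx : ~ A x by move=> Ax; apply: nx; exists 0; rewrite scale0r subr0.
  apply: (Amax (fun y => exists c w, A w /\ y = w + c *: x)).
    split=> [y Ay|e]; first by exists 0, y; rewrite scale0r addr0.
    by apply/nAx/e; exists 1, 0; rewrite add0r scale1r.
  split.
    case=> c [w [Aw e]].
    have [c0|c0] := eqVneq c 0.
      by apply: Av; rewrite e c0 scale0r addr0.
    apply: nx; exists c^-1; rewrite e scalerDr scalerA mulVf // scale1r.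
    by rewrite opprD addrCA subrr addr0 -scaleN1r; apply/AZ/AZ.
  move=> a _ _ [c [w [Aw ->]]] [c' [w' [Aw' ->]]].
  exists (a * c + c'), (a *: w + w'); split; first exact: Alin.
  by rewrite scalerDr scalerA scalerDl addrACA.
have uniq x c c' : A (x - c *: v) -> A (x - c' *: v) -> c = c'.
  move=> h h'; apply/eqP; apply: contrapT => /negP ne.
  apply: Av; have := AZ (c' - c)^-1 _ (AB _ _ h h').
  have -> : x - c *: v - (x - c' *: v) = (c' - c) *: v.
    by rewrite scalerBl opprB addrC addrA subrK.
  by rewrite scalerA mulVf ?scale1r // subr_eq0 eq_sym.
pose f x : k^o := projT1 (cid (dec x)).
have fP x : A (x - f x *: v) by rewrite /f; case: cid.
exists f; split.
  move=> a x y; apply: (uniq (a *: x + y)); first exact: fP.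
  have -> : a *: x + y - (a * f x + f y) *: v
            = a *: (x - f x *: v) + (y - f y *: v).
    by rewrite scalerDl scalerBr scalerA opprD addrACA.
  exact: Alin.
have -> : f v = 1 by apply: (uniq v) => //; rewrite scale1r subrr.
exact: oner_neq0.
Qed.

Section TensorAlgebra.
Variables (k : fieldType) (A B : algType k).

Definition tensor_mul (t t' : tensor A B) : tensor A B :=
  tensor_lift (fun a b => tensor_lift (fun a' b' => (a * a') ⊗ (b * b')) t') t.

Lemma tmul_bilin1 (a : A) (b : B) :
  bilin (fun a' b' => (a * a') ⊗ (b * b')).
Proof.
split=> [v|u] c x y; rewrite mulrDr -scalerAr.
  exact: (ptensor_bilin _ _).1.
exact: (ptensor_bilin _ _).2.
Qed.

Lemma tmul_bilin2 t' :
  bilin (fun (a : A) (b : B) => tensor_lift (fun a' b' => (a * a') ⊗ (b * b')) t').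
Proof.
pose F (a : A) (b : B) := tensor_lift (fun (a' : A) (b' : B) => (a * a') ⊗ (b * b')).
have FL a b : linear (F a b) by apply/tensor_lift_linear/tmul_bilin1.
have key (a : k) f g c : linear f -> linear g ->
  (forall x y, c (ptensor x y) = a *: f (ptensor x y) + g (ptensor x y)) ->
  linear c -> c t' = a *: f t' + g t' :> tensor A B.
  move=> lf lg h lc.
  apply: (linear_tensor_ext (f := c) (g := fun t => a *: f t + g t)) => //.
  move=> d x y; rewrite lf lg !scalerDr !scalerA mulrC -!addrA; congr (_ + _).
  by rewrite addrCA.
split=> [v|u] c x y; apply: (key _ (F _ _) (F _ _) (F _ _)) => // p q;
  rewrite /F !tensor_liftE; try exact: tmul_bilin1.
  by rewrite mulrDl -scalerAl (ptensor_bilin _ _).1.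
by rewrite mulrDl -scalerAl (ptensor_bilin _ _).2.
Qed.

Lemma tensor_mul_linl t' : linear (tensor_mul^~ t').
Proof. exact/tensor_lift_linear/tmul_bilin2. Qed.

Lemma tensor_mulE a b a' b' :
  tensor_mul (a ⊗ b) (a' ⊗ b') = (a * a') ⊗ (b * b').
Proof.
rewrite /tensor_mul tensor_liftE; last exact: tmul_bilin2.
by rewrite tensor_liftE //; apply: tmul_bilin1.
Qed.

Lemma tensor_mul_linr t : linear (tensor_mul t).
Proof.
move=> c x y.
apply: (linear_tensor_ext (f := fun t => tensor_mul t (c *: x + y))
  (g := fun t => c *: tensor_mul t x + tensor_mul t y)).
- exact: tensor_mul_linl.
- move=> d u v; rewrite !tensor_mul_linl !scalerDr !scalerA mulrC -!addrA.
  by congr (_ + _); rewrite addrCA.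
- move=> a b; rewrite /tensor_mul !(tensor_liftE _ _ (tmul_bilin2 _)).
  by rewrite (tensor_lift_linear (tmul_bilin1 _ _)).
Qed.

Lemma tensor_mul_bilin : bilin tensor_mul.
Proof. by split; [apply: tensor_mul_linl | apply: tensor_mul_linr]. Qed.

Definition tensor_one : tensor A B := 1 ⊗ 1.

Lemma tensor_mulA : associative tensor_mul.
Proof.
move=> x y z; elim/tensor_ind: x => [|x a b IH].
  by rewrite !(bilin0l tensor_mul_bilin).
rewrite !(bilinDl tensor_mul_bilin) IH; congr (_ + _) => {x IH}.
elim/tensor_ind: y => [|y a' b' IH].
  by rewrite (bilin0r tensor_mul_bilin) !(bilin0l tensor_mul_bilin)
             (bilin0r tensor_mul_bilin).
rewrite !(bilinDl tensor_mul_bilin) !(bilinDr tensor_mul_bilin) IH.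
rewrite !(bilinDl tensor_mul_bilin); congr (_ + _) => {y IH}.
elim/tensor_ind: z => [|z a'' b'' IH].
  by rewrite !(bilin0r tensor_mul_bilin).
rewrite !(bilinDr tensor_mul_bilin) IH; congr (_ + _).
by rewrite !tensor_mulE !mulrA.
Qed.

Lemma tensor_mul1 : left_id tensor_one tensor_mul.
Proof.
elim/tensor_ind => [|x a b IH]; first exact: (bilin0r tensor_mul_bilin).
by rewrite (bilinDr tensor_mul_bilin) IH tensor_mulE !mul1r.
Qed.

Lemma tensor_mulr1 : right_id tensor_one tensor_mul.
Proof.
elim/tensor_ind => [|x a b IH]; first exact: (bilin0l tensor_mul_bilin).
by rewrite (bilinDl tensor_mul_bilin) IH tensor_mulE !mulr1.
Qed.

Lemma tensor_mulDl : left_distributive tensor_mul +%R.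
Proof. by move=> x y z; rewrite (bilinDl tensor_mul_bilin). Qed.
Lemma tensor_mulDr : right_distributive tensor_mul +%R.
Proof. by move=> x y z; rewrite (bilinDr tensor_mul_bilin). Qed.

Lemma tensor_one_neq0 : tensor_one != 0.
Proof.
apply/eqP => e.
have [f [lf f1]] := linear_form_neq0 (oner_neq0 A).
have [g [lg g1]] := linear_form_neq0 (oner_neq0 B).
pose b x y : k^o := f x * g y.
have hb : bilin b.
  split=> [v|u] a x y; rewrite /b ?lf ?lg.
    by rewrite mulrDl -scalerAl.
  by rewrite mulrDr -scalerAr.
have := tensor_liftE 1 1 hb; rewrite -/tensor_one e.
rewrite (linf0 (tensor_lift_linear hb)) => /esym/eqP.
by rewrite mulf_eq0 (negPf f1) (negPf g1).
Qed.

HB.instance Definition _ := GRing.Zmodule_isNzRing.Build (tensor A B)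
  tensor_mulA tensor_mul1 tensor_mulr1 tensor_mulDl tensor_mulDr tensor_one_neq0.

Lemma tensor_scaleAl (a : k) (x y : tensor A B) : a *: (x * y) = a *: x * y.
Proof. by rewrite -(bilinZl tensor_mul_bilin). Qed.
Lemma tensor_scaleAr (a : k) (x y : tensor A B) : a *: (x * y) = x * (a *: y).
Proof. by rewrite -(bilinZr tensor_mul_bilin). Qed.
HB.instance Definition _ :=
  GRing.Lmodule_isLalgebra.Build k (tensor A B) tensor_scaleAl.
HB.instance Definition _ :=
  GRing.Lalgebra_isAlgebra.Build k (tensor A B) tensor_scaleAr.

Lemma ptensorM (a a' : A) (b b' : B) :
  (a ⊗ b) * (a' ⊗ b') = (a * a') ⊗ (b * b').
Proof. exact: tensor_mulE. Qed.
Lemma ptensor1 : (1 : tensor A B) = 1 ⊗ 1. Proof. by []. Qed.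
End TensorAlgebra.

Section TensorComAlgebra.
Variables (k : fieldType) (A B : comAlgType k).
Lemma tensor_mulC : commutative (@tensor_mul k A B).
Proof.
move=> x y; elim/tensor_ind: x => [|x a b IH].
  by rewrite (bilin0l (tensor_mul_bilin _ _)) (bilin0r (tensor_mul_bilin _ _)).
rewrite (bilinDl (tensor_mul_bilin _ _)) (bilinDr (tensor_mul_bilin _ _)) IH.
congr (_ + _) => {x IH}; elim/tensor_ind: y => [|y a' b' IH].
  by rewrite (bilin0l (tensor_mul_bilin _ _)) (bilin0r (tensor_mul_bilin _ _)).
rewrite (bilinDl (tensor_mul_bilin _ _)) (bilinDr (tensor_mul_bilin _ _)) IH.
by rewrite !tensor_mulE mulrC [b * _]mulrC.
Qed.
HB.instance Definition _ :=
  GRing.PzRing_hasCommutativeMul.Build (tensor A B) tensor_mulC.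
End TensorComAlgebra.



HB.mixin Record isBialgebra (k : fieldType) H of GRing.Algebra k H := {
  comul : H -> tensor H H;
  counit : H -> k;
  comul_linear : linear comul;
  comul_monoid_morphism : monoid_morphism comul;
  counit_linear : scalar counit;
  counit_monoid_morphism : monoid_morphism counit;
  comulA : forall x,
    tensor_assoc (tensor_map comul id (comul x)) = tensor_map id comul (comul x);
  counitl : forall x, tensor_lift (fun a b => counit a *: b) (comul x) = x;
  counitr : forall x, tensor_lift (fun a b => counit b *: a) (comul x) = x
}.

#[short(type="bialgType")]
HB.structure Definition Bialgebra (k : fieldType) :=
  { H of GRing.Algebra k H & isBialgebra k H }.

Section GroupLike.
Variables (k : fieldType) (H : bialgType k).

Definition is_grouplike (g : H) : bool :=
  `[< comul g = g ⊗ g /\ counit g = 1 >].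

Record grouplike := Grouplike {
  grouplike_val : H;
  grouplikeP : is_grouplike grouplike_val
}.
HB.instance Definition _ := [isSub for grouplike_val].
HB.instance Definition _ := [Choice of grouplike by <:].

Lemma is_grouplike1 : is_grouplike 1.
Proof.
apply/asboolP; split; last exact: counit_monoid_morphism.1.
by rewrite comul_monoid_morphism.1.
Qed.

Lemma is_grouplikeM (g h : grouplike) : is_grouplike (val g * val h).
Proof.
have [/asboolP [g1 g2] /asboolP [h1 h2]] := (valP g, valP h).
apply/asboolP; split; last by rewrite counit_monoid_morphism.2 g2 h2 mulr1.
by rewrite comul_monoid_morphism.2 g1 h1 ptensorM.
Qed.

Definition grouplike_one : grouplike := Grouplike is_grouplike1.
Definition grouplike_mul (g h : grouplike) : grouplike :=
  Grouplike (is_grouplikeM g h).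

Lemma grouplike_mulA : associative grouplike_mul.
Proof. by move=> x y z; apply: val_inj; rewrite /= mulrA. Qed.
Lemma grouplike_mul1 : left_id grouplike_one grouplike_mul.
Proof. by move=> x; apply: val_inj; rewrite /= mul1r. Qed.
Lemma grouplike_mulr1 : right_id grouplike_one grouplike_mul.
Proof. by move=> x; apply: val_inj; rewrite /= mulr1. Qed.
HB.instance Definition _ :=
  isMonoid.Build grouplike grouplike_mulA grouplike_mul1 grouplike_mulr1.
End GroupLike.

Section MonoidUnits.
Variable M : monoidType.
Local Open Scope group_scope.

Definition is_invertible (x : M) : bool :=
  `[< exists y, x * y = 1 /\ y * x = 1 >].

Record units := Units { unit_val : M; unit_valP : is_invertible unit_val }.
HB.instance Definition _ := [isSub for unit_val].
HB.instance Definition _ := [Choice of units by <:].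

Lemma is_invertible1 : is_invertible 1.
Proof. by apply/asboolP; exists 1; rewrite mulg1. Qed.

Lemma is_invertibleM (x y : units) : is_invertible (val x * val y).
Proof.
have [/asboolP [x' [e1 e2]] /asboolP [y' [e3 e4]]] := (valP x, valP y).
apply/asboolP; exists (y' * x').
by rewrite mulgA -(mulgA _ _ y') e3 mulg1 mulgA -(mulgA _ x') e2 mulg1.
Qed.

Lemma inv_exists (x : units) : exists y, val x * y = 1 /\ y * val x = 1.
Proof. exact/asboolP/(valP x). Qed.

Lemma is_invertibleV (x : units) : is_invertible (projT1 (cid (inv_exists x))).
Proof. by case: cid => y [e1 e2] /=; apply/asboolP; exists (val x). Qed.

Definition units_one : units := Units is_invertible1.
Definition units_mul (x y : units) : units := Units (is_invertibleM x y).
Definition units_inv (x : units) : units := Units (is_invertibleV x).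

Lemma units_mulA : associative units_mul.
Proof. by move=> x y z; apply: val_inj; rewrite /= mulgA. Qed.
Lemma units_mul1 : left_id units_one units_mul.
Proof. by move=> x; apply: val_inj; rewrite /= mul1g. Qed.
Lemma units_mulr1 : right_id units_one units_mul.
Proof. by move=> x; apply: val_inj; rewrite /= mulg1. Qed.
Lemma units_mulV : left_inverse units_one units_inv units_mul.
Proof. by move=> x; apply: val_inj; rewrite /=; case: cid => y []. Qed.
Lemma units_mulrV : right_inverse units_one units_inv units_mul.
Proof. by move=> x; apply: val_inj; rewrite /=; case: cid => y []. Qed.
HB.instance Definition _ :=
  isGroup.Build units units_mulA units_mul1 units_mulr1 units_mulV units_mulrV.
End MonoidUnits.

Section TwoSidedIdeal.
Variables (k : fieldType) (H : algType k).

Record two_sided_ideal (I : H -> Prop) : Prop := TwoSidedIdeal {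
  ideal_0 : I 0;
  ideal_D : forall x y, I x -> I y -> I (x + y);
  ideal_Ml : forall a x, I x -> I (a * x);
  ideal_Mr : forall a x, I x -> I (x * a)
}.

(* dim (H / I) < oo: the quotient H / I is isomorphic to k^m for some m. *)
Definition finite_codim (I : H -> Prop) : Prop :=
  exists (m : nat) (p : H -> 'rV[k]_m),
    [/\ linear p, forall v, exists x, p x = v & forall x, I x <-> p x = 0].

Lemma ker_finite_codim (m : nat) (p : H -> 'rV[k]_m) :
  linear p -> finite_codim (fun x => p x = 0).
Proof.
move=> lp.
pose Q r := exists s : 'I_r -> H, \rank (\matrix_i p (s i)) == r.
have Q0 : exists r, `[< Q r >].
  by exists 0%N; apply/asboolP; exists (fun=> 0); rewrite -leqn0 rank_leq_row.
have Qm r : `[< Q r >] -> (r <= m)%N.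
  by move=> /asboolP[s /eqP <-]; rewrite rank_leq_col.
case: (ex_maxnP Q0 Qm) => r /asboolP [s /eqP rk] rmax.
set M := \matrix_i p (s i) in rk.
have Msub x : (p x <= M)%MS.
  apply: contrapT => /negP nle.
  suff /rmax : `[< Q (r + 1)%N >] by rewrite addn1 ltnn.
  apply/asboolP; exists (fun i => match split i with inl j => s j | inr _ => x end).
  have -> : \matrix_i p (match split i with inl j => s j | inr _ => x end)
            = col_mx M (p x).
    apply/matrixP => i j; rewrite !mxE; case: split => i' //; first by rewrite mxE.
    by rewrite ord1.
  suff lt : (r < \rank (col_mx M (p x)))%N.
    by rewrite eqn_leq rank_leq_row /= (leq_trans _ lt) // addn1.
  have le : (r <= \rank (M + p x)%MS)%N.
    by apply: leq_trans (mxrankS (addsmxSl M (p x))); rewrite rk.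
  rewrite -addsmxE ltn_neqAle le andbT.
  apply: contra nle => /eqP e.
  have := (mxrank_leqif_sup (addsmxSl M (p x))).2.
  by rewrite rk -e eqxx => /esym; rewrite addsmx_sub => /andP[].
have Mfree : row_free M by rewrite /row_free rk.
exists r, (fun x => p x *m pinvmx M); split.
- by move=> a x y; rewrite lp mulmxDl scalemxAl.
- move=> v; exists (\sum_i v 0 i *: s i).
  have -> : p (\sum_i v 0 i *: s i) = v *m M.
    rewrite (linf_sum lp) mulmx_sum_row; apply: eq_bigr => i _.
    by rewrite (linfZ lp) rowK.
  by rewrite mulmxKp.
- move=> x; split=> [->|e]; first by rewrite mul0mx.
  by rewrite -(mulmxKpV (Msub x)) e mul0mx.
Qed.

End TwoSidedIdeal.

Section FiniteDualSpace.
Variables (k : fieldType) (H : algType k).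

Definition vanishes_cofinitely (f : H -> k) : Prop :=
  exists I : H -> Prop,
    [/\ two_sided_ideal I, finite_codim I & forall x, I x -> f x = 0].

Record finite_dual := FiniteDual {
  fdual_val :> H -> k;
  fdual_linear : scalar fdual_val;
  fdual_cofinite : vanishes_cofinitely fdual_val
}.

Lemma fdualP (f g : finite_dual) : f =1 g -> f = g.
Proof.
case: f g => [f lf cf] [g lg cg] /= /funext e; subst g.
by congr FiniteDual; apply: Prop_irrelevance.
Qed.

HB.instance Definition _ := gen_eqMixin finite_dual.
HB.instance Definition _ := gen_choiceMixin finite_dual.

Lemma fdual_zero_linear : scalar (fun _ : H => 0 : k).
Proof. by move=> a x y; rewrite mulr0 addr0. Qed.
Lemma fdual_zero_cofinite : vanishes_cofinitely (fun _ : H => 0 : k).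
Proof.
exists (fun=> True); split=> //.
have l0 : linear (fun _ : H => 0 : 'rV[k]_0).
  by move=> a x y; rewrite scaler0 addr0.
have [m [p [lp sp e]]] := ker_finite_codim l0.
by exists m, p; split=> // x; split=> // _; apply/e.
Qed.
Definition fdual_zero := FiniteDual fdual_zero_linear fdual_zero_cofinite.

Lemma ideal_kerI (f g : H -> k) : vanishes_cofinitely f -> vanishes_cofinitely g ->
  exists I : H -> Prop, [/\ two_sided_ideal I, finite_codim I,
    forall x, I x -> f x = 0 & forall x, I x -> g x = 0].
Proof.
move=> [I [iI [m [p [lp sp ep]]] If]] [J [iJ [n [q [lq sq eq]]] Jg]].
exists (fun x => I x /\ J x); split.
- split=> [|x y [? ?] [? ?]|a x [? ?]|a x [? ?]]; split;
  by [apply: ideal_0|apply: ideal_D|apply: ideal_Ml|apply: ideal_Mr].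
- have lpq : linear (fun x => row_mx (p x) (q x)).
    by move=> a x y; rewrite lp lq scale_row_mx add_row_mx.
  have [r [s [ls ss es]]] := ker_finite_codim lpq.
  exists r, s; split=> // x; rewrite -es ep eq.
  split=> [[-> ->]|]; first by rewrite row_mx0.
  by move=> e; have := e; rewrite -[0 in RHS]row_mx0 => /eq_row_mx.
- by move=> x [/If].
- by move=> x [_ /Jg].
Qed.

Lemma fdual_comb_cofinite (a : k) (f g : finite_dual) :
  vanishes_cofinitely (fun x => a * f x + g x).
Proof.
have [I [iI cI If Ig]] := ideal_kerI (fdual_cofinite f) (fdual_cofinite g).
by exists I; split=> // x Ix; rewrite If // Ig // mulr0 addr0.
Qed.
Lemma fdual_comb_linear (a : k) (f g : finite_dual) :
  scalar (fun x => a * f x + g x).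
Proof.
move=> b x y; rewrite !fdual_linear !mulrDr !mulrA [a * b]mulrC -!addrA.
by congr (_ + _); rewrite addrCA.
Qed.
Definition fdual_comb a f g := FiniteDual (fdual_comb_linear a f g)
  (fdual_comb_cofinite a f g).

Definition fdual_add f g := fdual_comb 1 f g.
Definition fdual_scale a f := fdual_comb a f fdual_zero.
Definition fdual_opp f := fdual_scale (-1) f.

Lemma fdual_addA : associative fdual_add.
Proof. by move=> f g h; apply: fdualP => x /=; rewrite !mul1r addrA. Qed.
Lemma fdual_addC : commutative fdual_add.
Proof. by move=> f g; apply: fdualP => x /=; rewrite !mul1r addrC. Qed.
Lemma fdual_add0 : left_id fdual_zero fdual_add.
Proof. by move=> f; apply: fdualP => x /=; rewrite mulr0 add0r. Qed.
Lemma fdual_addN : left_inverse fdual_zero fdual_opp fdual_add.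
Proof. by move=> f; apply: fdualP => x /=; rewrite mul1r addr0 mulN1r addNr. Qed.
HB.instance Definition _ :=
  GRing.isZmodule.Build finite_dual fdual_addA fdual_addC fdual_add0 fdual_addN.

Lemma fdual_scaleA a b f : fdual_scale a (fdual_scale b f) = fdual_scale (a * b) f.
Proof. by apply: fdualP => x /=; rewrite !addr0 mulrA. Qed.
Lemma fdual_scale1 : left_id 1 fdual_scale.
Proof. by move=> f; apply: fdualP => x /=; rewrite mul1r addr0. Qed.
Lemma fdual_scaleDr : right_distributive fdual_scale +%R.
Proof. by move=> a f g; apply: fdualP => x /=; rewrite !addr0 !mul1r mulrDr. Qed.
Lemma fdual_scaleDl f : {morph fdual_scale^~ f : a b / a + b}.
Proof. by move=> a b; apply: fdualP => x /=; rewrite !addr0 mul1r mulrDl. Qed.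
HB.instance Definition _ := GRing.Zmodule_isLmodule.Build k finite_dual
  fdual_scaleA fdual_scale1 fdual_scaleDr fdual_scaleDl.

Lemma fdualD (f g : finite_dual) x : (f + g) x = f x + g x.
Proof. by rewrite /= mul1r. Qed.
Lemma fdualZ a (f : finite_dual) x : (a *: f) x = a * f x.
Proof. by rewrite /= addr0. Qed.
Lemma fdual0 x : (0 : finite_dual) x = 0.
Proof. by []. Qed.
Lemma fdual_sum I (r : seq I) (F : I -> finite_dual) x :
  (\sum_(i <- r) F i) x = \sum_(i <- r) F i x.
Proof. by elim/big_rec2: _ => [|i y z _ <-]; rewrite ?fdualD ?fdual0. Qed.

Lemma alg_hom_cofinite (f : H -> k) :
  scalar f -> monoid_morphism f -> vanishes_cofinitely f.
Proof.
move=> lf mf; exists (fun x => f x = 0).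
have lf' : linear (f : H -> k^o) := lf.
split=> //; first split.
- exact: (linf0 lf').
- by move=> x y fx fy; rewrite (linfD lf' x y) fx fy addr0.
- by move=> a x fx; rewrite mf.2 fx mulr0.
- by move=> a x fx; rewrite mf.2 fx mul0r.
have lp : linear (fun x => const_mx (f x) : 'rV[k]_1).
  by move=> a x y; apply/matrixP=> i j; rewrite !mxE lf.
have [m [p [? ? e]]] := ker_finite_codim lp.
exists m, p; split=> // x; rewrite -e; split=> [->|].
  by apply/matrixP=> i j; rewrite !mxE.
by move=> /matrixP/(_ 0 0); rewrite !mxE.
Qed.

Definition fdual_ev2 (t : tensor finite_dual finite_dual) (x y : H) : k :=
  tensor_lift (fun f g : finite_dual => f x * g y : k^o) t.

End FiniteDualSpace.
Arguments fdual_ev2 {k H} t x y.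

Lemma kscaleE (k : fieldType) (a : k) (b : k^o) : a *: b = a * b.
Proof. by []. Qed.

Section Separation.
Variables (k : fieldType) (U V : lmodType k) (X Y : Type).
Variables (phi : U -> X -> k) (psi : V -> Y -> k).
Hypothesis phil : forall x, linear (phi^~ x : U -> k^o).
Hypothesis psil : forall y, linear (psi^~ y : V -> k^o).
Hypothesis phi_sep : forall u, (forall x, phi u x = 0) -> u = 0.
Hypothesis psi_sep : forall v, (forall y, psi v y = 0) -> v = 0.

Lemma phiE a u u' x : phi (a *: u + u') x = a * phi u x + phi u' x.
Proof. exact: phil. Qed.
Lemma psiE a v v' y : psi (a *: v + v') y = a * psi v y + psi v' y.
Proof. exact: psil. Qed.
Lemma psiZ a v y : psi (a *: v) y = a * psi v y.
Proof. exact: (linfZ (psil y)). Qed.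
Lemma psi_sum (I : Type) (r : seq I) F y :
  psi (\sum_(i <- r) F i) y = \sum_(i <- r) psi (F i) y.
Proof. exact: (linf_sum (psil y)). Qed.

Lemma pair_bilin x y : bilin (fun u v => phi u x * psi v y : k^o).
Proof.
split=> [v|u] a u1 u2.
  by rewrite phiE mulrDl kscaleE mulrA.
by rewrite psiE mulrDr kscaleE mulrCA.
Qed.

Lemma tensor_sep (t : tensor U V) :
  (forall x y, tensor_lift (fun u v => phi u x * psi v y : k^o) t = 0) -> t = 0.
Proof.
have [s ->] := tensor_sum t.
have liftE x y s' : tensor_lift (fun u v => phi u x * psi v y : k^o)
    (\sum_(p <- s') p.1 ⊗ p.2) = \sum_(p <- s') phi p.1 x * psi p.2 y.
  rewrite (linf_sum (tensor_lift_linear (pair_bilin x y))).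
  by apply: eq_bigr => p _; rewrite (tensor_liftE _ _ (pair_bilin x y)).
move=> h; have {h}: forall x y, \sum_(p <- s) phi p.1 x * psi p.2 y = 0.
  by move=> x y; rewrite -liftE.
have [n] := ubnP (size s); elim: n s => // n IH [|[u0 v0] s] /=.
  by rewrite big_nil.
rewrite ltnS => sn h.
have [u00|/eqP nu0] := EM (u0 = 0).
  rewrite big_cons /= u00 (bilin0l (ptensor_bilin _ _)) add0r.
  apply: IH => // x y; have := h x y.
  by rewrite big_cons /= u00 (linf0 (phil x)) mul0r add0r.
have [x0 c0] : exists x0, phi u0 x0 != 0.
  apply: contrapT => nx; move/eqP: nu0; apply; apply: phi_sep => x.
  by apply/eqP; apply: contrapT => /negP e; apply: nx; exists x.
set c := phi u0 x0 in c0.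
have v0E : v0 = \sum_(p <- s) (- (c^-1 * phi p.1 x0)) *: p.2.
  apply/eqP; rewrite -subr_eq0; apply/eqP; apply: psi_sep => y.
  rewrite -[- _]scaleN1r addrC psiE psi_sum mulN1r.
  under eq_bigr do rewrite psiZ mulNr.
  rewrite sumrN opprK; have := h x0 y; rewrite big_cons /= -/c => e.
  apply: (mulfI c0); rewrite mulr0 mulrDr addrC -[RHS]e; congr (_ + _).
  rewrite mulr_sumr; apply: eq_bigr => p _.
  by rewrite !mulrA mulfV // mul1r.
pose s' := [seq (p.1 - (c^-1 * phi p.1 x0) *: u0, p.2) | p <- s].
have -> : \sum_(p <- (u0, v0) :: s) p.1 ⊗ p.2 = \sum_(p <- s') p.1 ⊗ p.2.
  rewrite big_cons big_map /= v0E (bilin_sumr (ptensor_bilin _ _)) -big_split /=.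
  apply: eq_bigr => p _.
  rewrite -scaleNr (bilinDl (ptensor_bilin _ _)) (bilinZl (ptensor_bilin _ _)).
  by rewrite (bilinZr (ptensor_bilin _ _)) addrC.
apply: IH; first by rewrite size_map.
move=> x y; rewrite big_map /=.
have := h x y; rewrite big_cons /= {1}v0E psi_sum mulr_sumr -big_split /= => e.
rewrite -[RHS]e; apply: eq_bigr => p _.
rewrite -scaleNr [p.1 + _]addrC phiE psiZ mulrDl; congr (_ + _).
by rewrite mulrA [_ * phi u0 x]mulrC.
Qed.
End Separation.

Section FiniteDualBialgebra.
Variables (k : fieldType) (H : bialgType k).
Local Notation Ho := (finite_dual H).

Lemma fdual_lin (f : Ho) : linear (f : H -> k^o).
Proof. exact: fdual_linear. Qed.

Lemma fdual_pair_bilin (f g : Ho) : bilin (fun a b => f a * g b : k^o).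
Proof.
split=> [v|u] a x y; rewrite fdual_linear kscaleE.
  by rewrite mulrDl mulrA.
by rewrite mulrDr mulrCA.
Qed.

Definition convolution (f g : Ho) (x : H) : k :=
  tensor_lift (fun a b => f a * g b : k^o) (comul x).

Lemma convolutionE (f g : Ho) x s : comul x = \sum_(p <- s) p.1 ⊗ p.2 ->
  convolution f g x = \sum_(p <- s) f p.1 * g p.2.
Proof.
move=> e; rewrite /convolution e.
rewrite (linf_sum (tensor_lift_linear (fdual_pair_bilin f g))).
by apply: eq_bigr => p _; rewrite (tensor_liftE _ _ (fdual_pair_bilin f g)).
Qed.

Lemma convolution_linear f g : scalar (convolution f g).
Proof.
move=> a x y; rewrite /convolution comul_linear.
by rewrite (tensor_lift_linear (fdual_pair_bilin f g)).
Qed.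

Lemma factor_ker m r (p : H -> 'rV[k]_m) (T : H -> 'rV[k]_r) :
  linear p -> (forall v, exists x, p x = v) -> linear T ->
  (forall x, p x = 0 -> T x = 0) -> exists L, forall x, T x = p x *m L.
Proof.
move=> lp sp lT kT.
pose s i := projT1 (cid (sp (delta_mx 0 i))).
have sE i : p (s i) = delta_mx 0 i by rewrite /s; case: cid.
exists (\matrix_i T (s i)) => x.
have e : p (x - \sum_i p x 0 i *: s i) = 0.
  rewrite -scaleN1r addrC lp (linf_sum lp) scaleN1r.
  under eq_bigr do rewrite (linfZ lp) sE.
  by rewrite -row_sum_delta addNr.
have := kT _ e; rewrite -scaleN1r addrC lT (linf_sum lT) scaleN1r.
under eq_bigr do rewrite (linfZ lT).
rewrite addrC => /eqP; rewrite subr_eq0 => /eqP ->.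
by rewrite mulmx_sum_row; apply: eq_bigr => i _; rewrite rowK.
Qed.

Lemma convolution_cofinite f g : vanishes_cofinitely (convolution f g).
Proof.
have [I [iI [m [p [lp sp ep]]] If]] := fdual_cofinite f.
have [J [iJ [n [q [lq sq eq]]] Jg]] := fdual_cofinite g.
pose b (x y : H) := (p x)^T *m q y.
have hb : bilin b.
  split=> [v|u] a x y; rewrite /b.
    by rewrite lp linearP /= mulmxDl scalemxAl.
  by rewrite lq mulmxDr scalemxAr.
have lM := tensor_lift_linear hb.
set M := tensor_lift b in lM.
have lph : linear (fun x => mxvec (M (comul x))).
  by move=> a x y; rewrite comul_linear lM linearP.
have phE x : mxvec (M (comul x)) = 0 <-> M (comul x) = 0.
  split=> [e|->]; last by rewrite linear0.
  by rewrite -[M _]mxvecK e linear0.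
have multl a : exists L, forall x, p (a * x) = p x *m L.
  apply: (factor_ker (T := fun x => p (a * x))) => //.
    by move=> c x y; rewrite mulrDr -scalerAr lp.
  by move=> x /ep Ix; apply/ep/(ideal_Ml iI).
have multr a : exists L, forall x, p (x * a) = p x *m L.
  apply: (factor_ker (T := fun x => p (x * a))) => //.
    by move=> c x y; rewrite mulrDl -scalerAl lp.
  by move=> x /ep Ix; apply/ep/(ideal_Mr iI).
have multl' a : exists L, forall x, q (a * x) = q x *m L.
  apply: (factor_ker (T := fun x => q (a * x))) => //.
    by move=> c x y; rewrite mulrDr -scalerAr lq.
  by move=> x /eq Ix; apply/eq/(ideal_Ml iJ).
have multr' a : exists L, forall x, q (x * a) = q x *m L.
  apply: (factor_ker (T := fun x => q (x * a))) => //.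
    by move=> c x y; rewrite mulrDl -scalerAl lq.
  by move=> x /eq Ix; apply/eq/(ideal_Mr iJ).
have Ml s t : M t = 0 -> M (s * t) = 0.
  move=> t0; elim/tensor_ind: s => [|s a c IH]; first by rewrite mul0r (linf0 lM).
  rewrite mulrDl (linfD lM) IH addr0.
  have [L LE] := multl a; have [L' LE'] := multl' c.
  suff -> : M ((a ⊗ c) * t) = L^T *m M t *m L' by rewrite t0 mulmx0 mul0mx.
  apply: (linear_tensor_ext (f := fun t => M ((a ⊗ c) * t))
                            (g := fun t => L^T *m M t *m L')).
  - by move=> d x y; rewrite mulrDr -scalerAr lM.
  - by move=> d x y; rewrite lM mulmxDr mulmxDl -!(scalemxAr, scalemxAl).
  - move=> x y; rewrite ptensorM /M !tensor_liftE // /b LE LE'.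
    by rewrite trmx_mul !mulmxA.
have Mr s t : M t = 0 -> M (t * s) = 0.
  move=> t0; elim/tensor_ind: s => [|s a c IH]; first by rewrite mulr0 (linf0 lM).
  rewrite mulrDr (linfD lM) IH addr0.
  have [L LE] := multr a; have [L' LE'] := multr' c.
  suff -> : M (t * (a ⊗ c)) = L^T *m M t *m L' by rewrite t0 mulmx0 mul0mx.
  apply: (linear_tensor_ext (f := fun t => M (t * (a ⊗ c)))
                            (g := fun t => L^T *m M t *m L')).
  - by move=> d x y; rewrite mulrDl -scalerAl lM.
  - by move=> d x y; rewrite lM mulmxDr mulmxDl -!(scalemxAr, scalemxAl).
  - move=> x y; rewrite ptensorM /M !tensor_liftE // /b LE LE'.
    by rewrite trmx_mul !mulmxA.
exists (fun x => mxvec (M (comul x)) = 0); split; first split.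
- exact: (linf0 lph).
- by move=> x y ex ey; rewrite (linfD lph) ex ey addr0.
- move=> a x /phE e; apply/phE.
  by rewrite comul_monoid_morphism.2; apply: Ml.
- move=> a x /phE e; apply/phE.
  by rewrite comul_monoid_morphism.2; apply: Mr.
- exact: ker_finite_codim.
have fact (h : Ho) r (p' : H -> 'rV[k]_r) : linear p' ->
    (forall v, exists x, p' x = v) -> (forall x, p' x = 0 -> h x = 0) ->
    exists L : 'cV[k]_r, forall x, const_mx (h x) = p' x *m L.
  move=> lp' sp' h0.
  apply: (factor_ker (T := fun x => const_mx (h x) : 'rV[k]_1)) => //.
    by move=> a x y; apply/matrixP=> i j; rewrite !mxE fdual_linear.
  by move=> x /h0 ->; apply/matrixP=> i j; rewrite !mxE.
have [F FE] := fact f _ p lp sp (fun x h => If x ((ep x).2 h)).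
have [G GE] := fact g _ q lq sq (fun x h => Jg x ((eq x).2 h)).
move=> x /phE e.
suff : const_mx (convolution f g x) = F^T *m M (comul x) *m G :> 'M_1.
  by rewrite e mulmx0 mul0mx => /matrixP/(_ 0 0); rewrite !mxE.
rewrite /convolution.
apply: (linear_tensor_ext
  (f := fun t => const_mx (tensor_lift (fun a b => f a * g b : k^o) t) : 'M_1)
  (g := fun t => F^T *m M t *m G)).
- move=> d y z; rewrite (tensor_lift_linear (fdual_pair_bilin f g)).
  by apply/matrixP=> i j; rewrite !mxE.
- by move=> d y z; rewrite lM mulmxDr mulmxDl -!(scalemxAr, scalemxAl).
move=> y z; rewrite /M !tensor_liftE //; last exact: fdual_pair_bilin.
rewrite /b !mulmxA -trmx_mul -FE -mulmxA -GE.
by apply/matrixP=> i j; rewrite !mxE big_ord1 !mxE.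
Qed.

Definition fdual_mul (f g : Ho) : Ho :=
  FiniteDual (convolution_linear f g) (convolution_cofinite f g).

Lemma counit_cofinite : vanishes_cofinitely (@counit k H).
Proof. exact: alg_hom_cofinite counit_linear counit_monoid_morphism. Qed.

Definition fdual_one : Ho := FiniteDual counit_linear counit_cofinite.

Lemma fdual_mulA : associative fdual_mul.
Proof.
move=> f g h; apply: fdualP => x /=; rewrite /convolution /=.
pose gh (t : tensor H H) : k^o := tensor_lift (fun a b => g a * h b : k^o) t.
pose fg (t : tensor H H) : k^o := tensor_lift (fun a b => f a * g b : k^o) t.
have lgh : linear gh by apply/tensor_lift_linear/fdual_pair_bilin.
have lfg : linear fg by apply/tensor_lift_linear/fdual_pair_bilin.
have lid : linear (@id H) by [].
have lD := @comul_linear k H.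
have b1 : bilin (fun a t => f a * gh t : k^o).
  split=> [v|u] a y z; first by rewrite fdual_linear kscaleE mulrDl mulrA.
  by rewrite lgh !kscaleE mulrDr mulrCA.
have b2 : bilin (fun t a => fg t * h a : k^o).
  split=> [v|u] a y z; first by rewrite lfg !kscaleE mulrDl mulrA.
  by rewrite fdual_linear kscaleE mulrDr mulrCA.
transitivity (tensor_lift (fun a t => f a * gh t : k^o)
    (tensor_map id comul (comul x))); first by rewrite tensor_lift_map.
transitivity (tensor_lift (fun t a => fg t * h a : k^o)
    (tensor_map comul id (comul x))); last by rewrite tensor_lift_map.
rewrite -comulA; move: (tensor_map _ _ _).
have lA := @tensor_assoc_linear k H H H.
apply: (linear_tensor_ext (f := fun t =>
  tensor_lift (fun a t => f a * gh t : k^o) (tensor_assoc t))).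
- by move=> a y z; rewrite lA (tensor_lift_linear b1).
- exact: tensor_lift_linear.
move=> u c; rewrite [RHS]tensor_liftE //.
apply: (linear_tensor_ext (W := k^o) (f := fun u =>
   tensor_lift (fun a t => f a * gh t : k^o) (tensor_assoc (u ⊗ c)))
  (g := fun u => fg u * h c : k^o)).
- move=> a y z.
  by rewrite (ptensor_bilin _ _).1 lA (tensor_lift_linear b1).
- by move=> a y z; rewrite lfg !kscaleE mulrDl mulrA.
move=> a b; rewrite tensor_assocE tensor_liftE // /gh /fg.
by rewrite !(tensor_liftE _ _ (fdual_pair_bilin _ _)) mulrA.
Qed.

Lemma fdual_mul1 : left_id fdual_one fdual_mul.
Proof.
move=> f; apply: fdualP => x /=; have [s e] := tensor_sum (comul x).
rewrite (convolutionE _ _ e) /= -[in RHS](counitl x) e.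
have bl : bilin (fun (a b : H) => counit a *: b).
  split=> [v|u] a y z; first by rewrite counit_linear scalerDl scalerA.
  by rewrite scalerDr !scalerA mulrC.
rewrite (linf_sum (tensor_lift_linear bl)) [RHS](linf_sum (fdual_lin f)).
by apply: eq_bigr => p _; rewrite (tensor_liftE _ _ bl) (linfZ (fdual_lin f)).
Qed.

Lemma fdual_mulr1 : right_id fdual_one fdual_mul.
Proof.
move=> f; apply: fdualP => x /=; have [s e] := tensor_sum (comul x).
rewrite (convolutionE _ _ e) /= -[in RHS](counitr x) e.
have bl : bilin (fun (a b : H) => counit b *: a).
  split=> [v|u] a y z; first by rewrite scalerDr !scalerA mulrC.
  by rewrite counit_linear scalerDl scalerA.
rewrite (linf_sum (tensor_lift_linear bl)) [RHS](linf_sum (fdual_lin f)).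
by apply: eq_bigr => p _;
  rewrite (tensor_liftE _ _ bl) (linfZ (fdual_lin f)) kscaleE mulrC.
Qed.

Lemma fdual_mulDl : left_distributive fdual_mul +%R.
Proof.
move=> f g h; apply: fdualP => x; have [s e] := tensor_sum (comul x).
rewrite fdualD /= !(convolutionE _ _ e) -big_split.
by apply: eq_bigr => p _; rewrite fdualD mulrDl.
Qed.

Lemma fdual_mulDr : right_distributive fdual_mul +%R.
Proof.
move=> f g h; apply: fdualP => x; have [s e] := tensor_sum (comul x).
rewrite fdualD /= !(convolutionE _ _ e) -big_split.
by apply: eq_bigr => p _; rewrite fdualD mulrDr.
Qed.

Lemma fdual_one_neq0 : fdual_one != 0.
Proof.
apply/eqP => /(congr1 (fun f : Ho => f 1)) /=.
by rewrite counit_monoid_morphism.1 => /eqP; rewrite oner_eq0.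
Qed.

HB.instance Definition _ := GRing.Zmodule_isNzRing.Build Ho
  fdual_mulA fdual_mul1 fdual_mulr1 fdual_mulDl fdual_mulDr fdual_one_neq0.

Lemma fdualM (f g : Ho) x : (f * g) x = convolution f g x.
Proof. by []. Qed.
Lemma fdual1 x : (1 : Ho) x = counit x.
Proof. by []. Qed.

Lemma fdual_scaleAl (a : k) (f g : Ho) : a *: (f * g) = a *: f * g.
Proof.
apply: fdualP => x; have [s e] := tensor_sum (comul x).
rewrite fdualZ !fdualM !(convolutionE _ _ e) mulr_sumr.
by apply: eq_bigr => p _; rewrite fdualZ mulrA.
Qed.
Lemma fdual_scaleAr (a : k) (f g : Ho) : a *: (f * g) = f * (a *: g).
Proof.
apply: fdualP => x; have [s e] := tensor_sum (comul x).
rewrite fdualZ !fdualM !(convolutionE _ _ e) mulr_sumr.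
by apply: eq_bigr => p _; rewrite fdualZ mulrCA.
Qed.
HB.instance Definition _ := GRing.Lmodule_isLalgebra.Build k Ho fdual_scaleAl.
HB.instance Definition _ := GRing.Lalgebra_isAlgebra.Build k Ho fdual_scaleAr.

Lemma fdual_evl (x : H) : linear (fun f : Ho => f x : k^o).
Proof. by move=> a f g; rewrite fdualD fdualZ. Qed.

Lemma fdual_ev_bilin (x y : H) : bilin (fun f g : Ho => f x * g y : k^o).
Proof. exact: (pair_bilin fdual_evl fdual_evl). Qed.

Lemma fdual_ev2E (s : seq (Ho * Ho)) x y :
  fdual_ev2 (\sum_(p <- s) p.1 ⊗ p.2) x y = \sum_(p <- s) p.1 x * p.2 y.
Proof.
rewrite /fdual_ev2 (linf_sum (tensor_lift_linear (fdual_ev_bilin x y))).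
by apply: eq_bigr => p _; rewrite (tensor_liftE _ _ (fdual_ev_bilin x y)).
Qed.

Lemma fdual_ev2_linear x y : linear (fun t : tensor Ho Ho => fdual_ev2 t x y : k^o).
Proof. exact/tensor_lift_linear/fdual_ev_bilin. Qed.

Lemma fdual_sep (f : Ho) : (forall x, f x = 0) -> f = 0.
Proof. by move=> h; apply: fdualP. Qed.

Lemma fdual_ev2_sep (t : tensor Ho Ho) : (forall x y, fdual_ev2 t x y = 0) -> t = 0.
Proof. exact: (tensor_sep fdual_evl fdual_evl fdual_sep fdual_sep). Qed.

Lemma fdual_ev2_inj (t t' : tensor Ho Ho) :
  (forall x y, fdual_ev2 t x y = fdual_ev2 t' x y) -> t = t'.
Proof.
move=> h; apply/eqP; rewrite -subr_eq0; apply/eqP; apply: fdual_ev2_sep => x y.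
rewrite -scaleN1r addrC [LHS]fdual_ev2_linear kscaleE mulN1r h.
by rewrite addNr.
Qed.

Lemma fdual_comul_exists (f : Ho) :
  exists t : tensor Ho Ho, forall x y, fdual_ev2 t x y = f (x * y).
Proof.
have [I [iI [m [p [lp sp ep]]] If]] := fdual_cofinite f.
pose s i := projT1 (cid (sp (delta_mx 0 i))).
have sE i : p (s i) = delta_mx 0 i by rewrite /s; case: cid.
have lP i : scalar (fun x => p x 0 i) by move=> a x y; rewrite lp !mxE.
have cP i : vanishes_cofinitely (fun x => p x 0 i).
  exists I; split=> //; first by exists m, p.
  by move=> x /ep ->; rewrite mxE.
have lQ i : scalar (fun y => f (s i * y)).
  by move=> a x y; rewrite mulrDr -scalerAr fdual_linear.
have cQ i : vanishes_cofinitely (fun y => f (s i * y)).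
  exists I; split=> //; first by exists m, p.
  by move=> x Ix; apply/If/(ideal_Ml iI).
exists (\sum_(q <- [seq (FiniteDual (lP i) (cP i), FiniteDual (lQ i) (cQ i))
                     | i <- enum 'I_m]) q.1 ⊗ q.2) => x y.
rewrite fdual_ev2E big_map big_enum /=.
have : f ((x - \sum_i p x 0 i *: s i) * y) = 0.
  apply/If/(ideal_Mr iI); apply/ep.
  rewrite -scaleN1r addrC lp (linf_sum lp) scaleN1r.
  under eq_bigr do rewrite (linfZ lp) sE.
  by rewrite -row_sum_delta addNr.
rewrite mulrBl -scaleN1r addrC fdual_linear mulN1r addrC => /eqP.
rewrite subr_eq0 => /eqP ->; rewrite mulr_suml [RHS](linf_sum (fdual_lin f)).
by apply: eq_bigr => i _; rewrite -scalerAl (linfZ (fdual_lin f)).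
Qed.

(* The restriction to H° of the transpose of the multiplication of H, read
   through the embedding fdual_ev2 of H° ⊗ H° into the dual of H ⊗ H
   (fdual_ev2_inj): fdual_comul f = sum_p f_p ⊗ g_p is the unique tensor with
   f (x * y) = sum_p f_p x * g_p y. *)
Definition fdual_comul (f : Ho) : tensor Ho Ho :=
  projT1 (cid (fdual_comul_exists f)).
Definition fdual_counit (f : Ho) : k := f 1.

Lemma fdual_comulE (f : Ho) x y : fdual_ev2 (fdual_comul f) x y = f (x * y).
Proof. by rewrite /fdual_comul; case: cid => t /=. Qed.

Lemma fdual_comul_linear : linear fdual_comul.
Proof.
move=> a f g; apply: fdual_ev2_inj => x y.
by rewrite [RHS]fdual_ev2_linear !fdual_comulE fdualD fdualZ.
Qed.

Lemma fdual_comul_monoid_morphism : monoid_morphism fdual_comul.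
Proof.
split=> [|f g]; apply: fdual_ev2_inj => x y; rewrite fdual_comulE.
  rewrite ptensor1 /fdual_ev2 (tensor_liftE _ _ (fdual_ev_bilin x y)) !fdual1.
  exact: counit_monoid_morphism.2.
have [s es] := tensor_sum (comul x); have [s' es'] := tensor_sum (comul y).
have [r er] := tensor_sum (fdual_comul f).
have [r' er'] := tensor_sum (fdual_comul g).
have fE a b : f (a * b) = \sum_(p <- r) p.1 a * p.2 b.
  by rewrite -fdual_comulE er fdual_ev2E.
have gE a b : g (a * b) = \sum_(p <- r') p.1 a * p.2 b.
  by rewrite -fdual_comulE er' fdual_ev2E.
have -> : (f * g) (x * y) = \sum_(i <- s) \sum_(j <- s')
    f (i.1 * j.1) * g (i.2 * j.2).
  rewrite fdualM /convolution comul_monoid_morphism.2 es es'.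
  have lT := tensor_lift_linear (fdual_pair_bilin f g).
  rewrite mulr_suml (linf_sum lT); apply: eq_bigr => i _.
  rewrite mulr_sumr (linf_sum lT); apply: eq_bigr => j _.
  by rewrite ptensorM (tensor_liftE _ _ (fdual_pair_bilin f g)).
have -> : fdual_ev2 (fdual_comul f * fdual_comul g) x y =
    \sum_(p <- r) \sum_(q <- r') (p.1 * q.1) x * (p.2 * q.2) y.
  have lT := fdual_ev2_linear x y.
  rewrite er er' mulr_suml (linf_sum lT); apply: eq_bigr => i _.
  rewrite mulr_sumr (linf_sum lT); apply: eq_bigr => j _.
  by rewrite ptensorM /fdual_ev2 (tensor_liftE _ _ (fdual_ev_bilin x y)).
transitivity (\sum_(i <- s) \sum_(j <- s') \sum_(p <- r) \sum_(q <- r')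
    (p.1 i.1 * q.1 i.2) * (p.2 j.1 * q.2 j.2)).
  apply: eq_bigr => i _; apply: eq_bigr => j _.
  rewrite fE gE big_distrlr /=; apply: eq_bigr => p _; apply: eq_bigr => q _.
  by rewrite mulrACA.
transitivity (\sum_(p <- r) \sum_(q <- r') \sum_(i <- s) \sum_(j <- s')
    (p.1 i.1 * q.1 i.2) * (p.2 j.1 * q.2 j.2)); last first.
  apply: eq_bigr => p _; apply: eq_bigr => q _.
  by rewrite !fdualM (convolutionE _ _ es) (convolutionE _ _ es') big_distrlr.
under eq_bigr do rewrite exchange_big /=.
rewrite exchange_big /=; apply: eq_bigr => p _.
rewrite [RHS]exchange_big /=; apply: eq_bigr => i _.
by rewrite [RHS]exchange_big.
Qed.

Lemma fdual_counit_linear : scalar fdual_counit.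
Proof. by move=> a f g; rewrite /fdual_counit fdualD fdualZ. Qed.

Lemma fdual_counit_monoid_morphism : monoid_morphism fdual_counit.
Proof.
split=> [|f g]; rewrite /fdual_counit; first exact: counit_monoid_morphism.1.
rewrite fdualM /convolution comul_monoid_morphism.1 ptensor1.
by rewrite (tensor_liftE _ _ (fdual_pair_bilin f g)).
Qed.

Definition fdual_ev3 (t : tensor Ho (tensor Ho Ho)) (x y z : H) : k :=
  tensor_lift (fun (f : Ho) u => f x * fdual_ev2 u y z : k^o) t.

Lemma fdual_ev3_bilin (x y z : H) :
  bilin (fun (f : Ho) u => f x * fdual_ev2 u y z : k^o).
Proof.
exact: (pair_bilin (psi := fun u yz => fdual_ev2 u yz.1 yz.2) fdual_evl
          (fun yz => fdual_ev2_linear yz.1 yz.2) x (y, z)).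
Qed.

Lemma fdual_ev3_linear x y z :
  linear (fun t : tensor Ho (tensor Ho Ho) => fdual_ev3 t x y z : k^o).
Proof. exact/tensor_lift_linear/fdual_ev3_bilin. Qed.

Lemma fdual_ev3_inj (t t' : tensor Ho (tensor Ho Ho)) :
  (forall x y z, fdual_ev3 t x y z = fdual_ev3 t' x y z) -> t = t'.
Proof.
move=> h; apply/eqP; rewrite -subr_eq0; apply/eqP.
apply: (tensor_sep (psi := fun u yz => fdual_ev2 u yz.1 yz.2) fdual_evl
  (fun yz => fdual_ev2_linear yz.1 yz.2) fdual_sep) => [u hu|x [y z]].
  by apply: fdual_ev2_sep => y z; apply: (hu (y, z)).
rewrite -[LHS]/(fdual_ev3 _ x y z) -scaleN1r addrC [LHS]fdual_ev3_linear h.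
by rewrite kscaleE mulN1r addNr.
Qed.

Lemma fdual_comulA f :
  tensor_assoc (tensor_map fdual_comul id (fdual_comul f))
  = tensor_map id fdual_comul (fdual_comul f).
Proof.
apply: fdual_ev3_inj => x y z.
have lid : linear (@id Ho) by [].
have lC := fdual_comul_linear.
have lA := @tensor_assoc_linear k Ho Ho Ho.
have fE a b : fdual_ev2 (fdual_comul f) a b = f (a * b) by exact: fdual_comulE.
have [s es] := tensor_sum (fdual_comul f).
have {}fE a b : f (a * b) = \sum_(p <- s) p.1 a * p.2 b.
  by rewrite -fE es fdual_ev2E.
rewrite es !(linf_sum (tensor_map_linear _ _)) // (linf_sum lA).
rewrite !(linf_sum (fdual_ev3_linear x y z)).
transitivity (f (x * y * z)).
  rewrite fE; apply: eq_bigr => p _; rewrite tensor_mapE // -fdual_comulE.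
  apply: (linear_tensor_ext (W := k^o)
    (f := fun u => fdual_ev3 (tensor_assoc (u ⊗ p.2)) x y z)
    (g := fun u => fdual_ev2 u x y * p.2 z : k^o)).
  - by move=> a u v; rewrite (ptensor_bilin _ _).1 lA [LHS]fdual_ev3_linear.
  - move=> a u v; rewrite [fdual_ev2 _ _ _]fdual_ev2_linear !kscaleE.
    by rewrite mulrDl mulrA.
  move=> g h; rewrite tensor_assocE /fdual_ev3.
  rewrite (tensor_liftE _ _ (fdual_ev3_bilin x y z)) /fdual_ev2.
  by rewrite !(tensor_liftE _ _ (fdual_ev_bilin _ _)) mulrA.
rewrite -mulrA fE; apply: eq_bigr => p _; rewrite tensor_mapE //.
by rewrite /fdual_ev3 (tensor_liftE _ _ (fdual_ev3_bilin x y z)) fdual_comulE.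
Qed.

Lemma fdual_counitl f :
  tensor_lift (fun g h : Ho => fdual_counit g *: h) (fdual_comul f) = f.
Proof.
have bl : bilin (fun g h : Ho => fdual_counit g *: h).
  split=> [v|u] a g h; first by rewrite fdual_counit_linear scalerDl scalerA.
  by rewrite scalerDr !scalerA mulrC.
apply: fdualP => x; rewrite -[in RHS](mul1r x) -fdual_comulE.
have [s ->] := tensor_sum (fdual_comul f).
rewrite (linf_sum (tensor_lift_linear bl)) fdual_sum fdual_ev2E.
by apply: eq_bigr => p _; rewrite (tensor_liftE _ _ bl) fdualZ.
Qed.

Lemma fdual_counitr f :
  tensor_lift (fun g h : Ho => fdual_counit h *: g) (fdual_comul f) = f.
Proof.
have bl : bilin (fun g h : Ho => fdual_counit h *: g).
  split=> [v|u] a g h; first by rewrite scalerDr !scalerA mulrC.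
  by rewrite fdual_counit_linear scalerDl scalerA.
apply: fdualP => x; rewrite -[in RHS](mulr1 x) -fdual_comulE.
have [s ->] := tensor_sum (fdual_comul f).
rewrite (linf_sum (tensor_lift_linear bl)) fdual_sum fdual_ev2E.
by apply: eq_bigr => p _; rewrite (tensor_liftE _ _ bl) fdualZ mulrC.
Qed.

HB.instance Definition _ := isBialgebra.Build k Ho
  fdual_comul_linear fdual_comul_monoid_morphism
  fdual_counit_linear fdual_counit_monoid_morphism
  fdual_comulA fdual_counitl fdual_counitr.

Lemma fdual_grouplikeP (f : Ho) :
  is_grouplike f <-> monoid_morphism (f : H -> k).
Proof.
have E x y : fdual_ev2 (f ⊗ f) x y = f x * f y.
  by rewrite /fdual_ev2 (tensor_liftE _ _ (fdual_ev_bilin x y)).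
split=> [/asboolP[e1 e2]|m].
  by split=> // x y; rewrite -fdual_comulE -[fdual_comul f]/(comul f) e1 E.
apply/asboolP; split; last exact: m.1.
by apply: fdual_ev2_inj => x y; rewrite fdual_comulE E m.2.
Qed.

End FiniteDualBialgebra.

Section MultiplicativeLifts.
Variables (k : fieldType) (A B : algType k).

Lemma tensor_lift_monoid (S : algType k) (b : A -> B -> S) :
  bilin b -> b 1 1 = 1 ->
  (forall x x' y y', b (x * x') (y * y') = b x y * b x' y') ->
  monoid_morphism (tensor_lift b).
Proof.
move=> hb b1 bM; split=> [|s t]; first by rewrite ptensor1 tensor_liftE.
have lb := tensor_lift_linear hb.
elim/tensor_ind: s => [|s x y IH]; first by rewrite mul0r (linf0 lb) mul0r.
rewrite mulrDl !(linfD lb) IH mulrDl; congr (_ + _) => {s IH}.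
elim/tensor_ind: t => [|t x' y' IH]; first by rewrite mulr0 (linf0 lb) mulr0.
by rewrite mulrDr !(linfD lb) IH mulrDr ptensorM !tensor_liftE // bM.
Qed.

Lemma tensor_map_monoid (A' B' : algType k) (f : A -> A') (g : B -> B') :
  linear f -> linear g -> monoid_morphism f -> monoid_morphism g ->
  monoid_morphism (tensor_map f g).
Proof.
move=> lf lg mf mg; apply: tensor_lift_monoid.
- exact: tensor_map_bilin.
- by rewrite mf.1 mg.1.
- by move=> x x' y y'; rewrite mf.2 mg.2 ptensorM.
Qed.

End MultiplicativeLifts.

Lemma tensor_assoc_monoid (k : fieldType) (A B C : algType k) :
  monoid_morphism (@tensor_assoc k A B C).
Proof.
have hb c := @assoc_bilin1 k A B C c.
apply: tensor_lift_monoid; first exact: assoc_bilin.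
  by rewrite ptensor1 (tensor_liftE _ _ (hb 1)).
move=> s t c d.
have l c0 := tensor_lift_linear (hb c0).
elim/tensor_ind: s => [|s x y IH]; first by rewrite mul0r !(linf0 (l _)) mul0r.
rewrite mulrDl !(linfD (l _)) IH mulrDl; congr (_ + _) => {s IH}.
elim/tensor_ind: t => [|t x' y' IH]; first by rewrite mulr0 !(linf0 (l _)) mulr0.
rewrite mulrDr !(linfD (l _)) IH mulrDr; congr (_ + _).
by rewrite ptensorM !(tensor_liftE _ _ (hb _)) !ptensorM.
Qed.

(* The universal algebra of a family tau of structure constants, where
   tau i j s is the coefficient of e_s in [e_i, e_j]. The variable X_ij of the
   polynomial ring in n * n variables is the one of index mxvec_index i j. *)
Section UniversalAlgebra.
Variables (k : fieldType) (n : nat) (tau : 'I_n -> 'I_n -> 'I_n -> k).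
Local Notation P := {mpoly k[n * n]}.

Definition polyvar (i j : 'I_n) : P := 'X_(mxvec_index i j).

Definition univ_rel (a i j : 'I_n) : P :=
  \sum_u tau i j u *: polyvar a u
  - \sum_s \sum_t tau s t a *: (polyvar s i * polyvar t j).

Definition univ_ideal (p : P) : bool :=
  `[< exists c : 'I_n -> 'I_n -> 'I_n -> P,
        p = \sum_a \sum_i \sum_j c a i j * univ_rel a i j >].

Section Eval.
Variables (S : comAlgType k) (h : 'I_n -> 'I_n -> S).

Definition poly_eval (p : P) : S :=
  mmap (in_alg S) (fun v => mxvec (\matrix_(i, j) h i j) 0 v) p.

Lemma poly_evalX i j : poly_eval (polyvar i j) = h i j.
Proof. by rewrite /poly_eval /polyvar mmapX mmap1U mxvecE mxE. Qed.

Lemma poly_eval_linear : linear poly_eval.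
Proof.
by move=> a p q; rewrite /poly_eval mmapD mmapZ /= mulr_algl.
Qed.

Lemma poly_eval_monoid : monoid_morphism poly_eval.
Proof.
have [e1 e2] := mmap_is_multiplicative
  (fun v => mxvec (\matrix_(i, j) h i j) 0 v) (in_alg S).
by split; [exact: e2 | exact: e1].
Qed.

Hypothesis hP : forall a i j, \sum_u tau i j u *: h a u
  = \sum_s \sum_t tau s t a *: (h s i * h t j).

Lemma poly_eval_ideal p : univ_ideal p -> poly_eval p = 0.
Proof.
have l := poly_eval_linear; have m := poly_eval_monoid.
have r a i j : poly_eval (univ_rel a i j) = 0.
  rewrite /univ_rel -scaleN1r addrC l scaleN1r !(linf_sum l).
  apply/eqP; rewrite addrC subr_eq0; apply/eqP.
  under eq_bigr do rewrite (linfZ l) poly_evalX.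
  rewrite hP; apply: eq_bigr => s _; rewrite (linf_sum l).
  by apply: eq_bigr => t _; rewrite (linfZ l) m.2 !poly_evalX.
move=> /asboolP[c ->]; rewrite (linf_sum l) big1 // => a _.
rewrite (linf_sum l) big1 // => i _; rewrite (linf_sum l) big1 // => j _.
by rewrite m.2 r mulr0.
Qed.
End Eval.

Lemma delta_hom a i j : \sum_u tau i j u *: ((a == u)%:R : k^o)
  = \sum_s \sum_t tau s t a *: ((s == i)%:R * (t == j)%:R : k^o).
Proof.
rewrite (bigD1 a) //= eqxx big1 ?addr0; last first.
  by move=> u /negPf ua; rewrite eq_sym ua scaler0.
rewrite (bigD1 i) //= [X in _ + X]big1 ?addr0; last first.
  by move=> s /negPf si; rewrite big1 // => t _; rewrite si mul0r scaler0.
rewrite (bigD1 j) //= [X in _ + X]big1 ?addr0; last first.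
  by move=> t /negPf tj; rewrite tj mulr0 scaler0.
by rewrite !eqxx mulr1.
Qed.

Lemma univ_ideal_closed : idealr_closed univ_ideal.
Proof.
split.
- apply/asboolP; exists (fun _ _ _ => 0).
  rewrite big1 // => a _; rewrite big1 // => i _; rewrite big1 // => j _.
  by rewrite mul0r.
- apply/negP => /(poly_eval_ideal delta_hom).
  by rewrite (poly_eval_monoid _).1 => /eqP; rewrite oner_eq0.
- move=> p u v /asboolP[c ->] /asboolP[d ->]; apply/asboolP.
  exists (fun a i j => p * c a i j + d a i j).
  rewrite mulr_sumr -big_split; apply: eq_bigr => a _ /=.
  rewrite mulr_sumr -big_split; apply: eq_bigr => i _ /=.
  rewrite mulr_sumr -big_split; apply: eq_bigr => j _ /=.
  by rewrite mulrDl mulrA.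
Qed.

HB.instance Definition _ := isIdealr.Build P univ_ideal univ_ideal_closed.

Definition univ_idealr : idealr P := Idealr.clone P univ_ideal _.
Definition univ_alg : Type := {ideal_quot univ_idealr}.
HB.instance Definition _ := GRing.ComNzRing.on univ_alg.

Definition univ_proj (p : P) : univ_alg := \pi_({ideal_quot univ_idealr}) p.

Lemma univ_projD p q : univ_proj (p + q) = univ_proj p + univ_proj q.
Proof. by rewrite /univ_proj piE. Qed.
Lemma univ_projM p q : univ_proj (p * q) = univ_proj p * univ_proj q.
Proof. by rewrite /univ_proj piE. Qed.
Lemma univ_proj1 : univ_proj 1 = 1.
Proof. by rewrite /univ_proj piE. Qed.
Lemma univ_projP p q : univ_proj p = univ_proj q <-> univ_ideal (p - q).
Proof.
rewrite -[univ_ideal _]/(p - q \in univ_idealr) Quotient.idealrBE.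
by split=> /eqP.
Qed.
Lemma univ_repr (x : univ_alg) : exists p, x = univ_proj p.
Proof. by exists (repr (x : {ideal_quot univ_idealr})); rewrite /univ_proj reprK. Qed.

Definition univ_scale (a : k) (x : univ_alg) : univ_alg := univ_proj a%:MP * x.

Lemma univ_scaleA a b x : univ_scale a (univ_scale b x) = univ_scale (a * b) x.
Proof. by rewrite /univ_scale mulrA -univ_projM mpolyCM. Qed.
Lemma univ_scale1 : left_id 1 univ_scale.
Proof. by move=> x; rewrite /univ_scale mpolyC1 univ_proj1 mul1r. Qed.
Lemma univ_scaleDr : right_distributive univ_scale +%R.
Proof. by move=> a x y; rewrite /univ_scale mulrDr. Qed.
Lemma univ_scaleDl x : {morph univ_scale^~ x : a b / a + b}.
Proof. by move=> a b; rewrite /univ_scale mpolyCD univ_projD mulrDl. Qed.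
HB.instance Definition _ := GRing.Zmodule_isLmodule.Build k univ_alg
  univ_scaleA univ_scale1 univ_scaleDr univ_scaleDl.
Lemma univ_scaleAl (a : k) (x y : univ_alg) : a *: (x * y) = a *: x * y.
Proof. exact: mulrA. Qed.
HB.instance Definition _ := GRing.Lmodule_isLalgebra.Build k univ_alg univ_scaleAl.
HB.instance Definition _ := GRing.Lalgebra_isComAlgebra.Build k univ_alg.

Lemma univ_projZ a p : univ_proj (a *: p) = a *: univ_proj p.
Proof. by rewrite -mul_mpolyC univ_projM. Qed.
Lemma univ_proj_linear : linear univ_proj.
Proof. by move=> a p q; rewrite univ_projD univ_projZ. Qed.

Definition univ_gen (i j : 'I_n) : univ_alg := univ_proj (polyvar i j).

Lemma univ_gen_rel a i j : \sum_u tau i j u *: univ_gen a u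
  = \sum_s \sum_t tau s t a *: (univ_gen s i * univ_gen t j).
Proof.
have l := univ_proj_linear.
have : univ_proj (univ_rel a i j) = univ_proj 0.
  apply/univ_projP; rewrite subr0; apply/asboolP.
  exists (fun a' i' j' => ((a' == a) && (i' == i) && (j' == j))%:R).
  rewrite (bigD1 a) //= [X in _ + X]big1 ?addr0; last first.
    move=> s /negPf e; rewrite big1 // => t _; rewrite big1 // => u _.
    by rewrite e mul0r.
  rewrite (bigD1 i) //= [X in _ + X]big1 ?addr0; last first.
    by move=> s /negPf e; rewrite big1 // => t _; rewrite e andbF mul0r.
  rewrite (bigD1 j) //= [X in _ + X]big1 ?addr0; last first.
    by move=> s /negPf e; rewrite e andbF mul0r.
  by rewrite !eqxx mul1r.
rewrite /univ_rel -scaleN1r addrC l scaleN1r (linf0 l) addrC => /eqP.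
rewrite subr_eq0 !(linf_sum l) => /eqP e.
transitivity (\sum_u univ_proj (tau i j u *: polyvar a u)).
  by apply: eq_bigr => u _; rewrite univ_projZ.
rewrite e; apply: eq_bigr => s _; rewrite (linf_sum l).
by apply: eq_bigr => t _; rewrite univ_projZ univ_projM.
Qed.

Definition univ_eval (S : comAlgType k) (h : 'I_n -> 'I_n -> S) (x : univ_alg) : S :=
  poly_eval h (repr (x : {ideal_quot univ_idealr})).

Section UnivEval.
Variables (S : comAlgType k) (h : 'I_n -> 'I_n -> S).
Hypothesis hP : forall a i j, \sum_u tau i j u *: h a u
  = \sum_s \sum_t tau s t a *: (h s i * h t j).

Lemma univ_eval_proj p : univ_eval h (univ_proj p) = poly_eval h p.
Proof.
apply/eqP; rewrite -subr_eq0; apply/eqP.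
have l := poly_eval_linear h.
rewrite -scaleN1r addrC -l scaleN1r addrC; apply: (poly_eval_ideal hP).
by apply/univ_projP; rewrite /univ_proj reprK.
Qed.

Lemma univ_eval_gen i j : univ_eval h (univ_gen i j) = h i j.
Proof. by rewrite univ_eval_proj poly_evalX. Qed.

Lemma univ_eval_linear : linear (univ_eval h).
Proof.
move=> a x y; have [[p ->] [q ->]] := (univ_repr x, univ_repr y).
by rewrite -univ_projZ -univ_projD !univ_eval_proj poly_eval_linear.
Qed.

Lemma univ_eval_monoid : monoid_morphism (univ_eval h).
Proof.
split=> [|x y]; first by rewrite -univ_proj1 univ_eval_proj (poly_eval_monoid _).1.
have [[p ->] [q ->]] := (univ_repr x, univ_repr y).
by rewrite -univ_projM !univ_eval_proj (poly_eval_monoid _).2.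
Qed.
End UnivEval.

Lemma univ_hom_ext (S : algType k) (f g : univ_alg -> S) :
  linear f -> linear g -> monoid_morphism f -> monoid_morphism g ->
  (forall i j, f (univ_gen i j) = g (univ_gen i j)) -> f =1 g.
Proof.
move=> lf lg mf mg e x; have [p ->] := univ_repr x.
have lp := univ_proj_linear.
elim/mpolyind: p => [|c m p _ _ IH]; first by rewrite (linf0 lp) (linf0 lf) (linf0 lg).
rewrite lp lf lg IH; congr (_ *: _ + _).
rewrite mpolyXE_id.
elim/big_rec: _ => [|v q _ IHq]; first by rewrite univ_proj1 mf.1 mg.1.
rewrite univ_projM mf.2 mg.2 IHq; congr (_ * _).
elim: (m v) => [|d IHd]; first by rewrite !expr0 univ_proj1 mf.1 mg.1.
rewrite !exprS univ_projM mf.2 mg.2 IHd; congr (_ * _).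
by case/mxvec_indexP: v {IHd} => i j; apply: e.
Qed.

Definition univ_comul : univ_alg -> tensor univ_alg univ_alg :=
  univ_eval (fun i j => \sum_s univ_gen i s ⊗ univ_gen s j).
Definition univ_counit : univ_alg -> k :=
  univ_eval (fun i j => (i == j)%:R : k^o).

Lemma comul_hom a i j :
  \sum_u tau i j u *: (\sum_s univ_gen a s ⊗ univ_gen s u)
  = \sum_s \sum_t tau s t a *: ((\sum_p univ_gen s p ⊗ univ_gen p i)
                                * (\sum_q univ_gen t q ⊗ univ_gen q j)).
Proof.
have bt := @ptensor_bilin k univ_alg univ_alg.
transitivity (\sum_s univ_gen a s ⊗ (\sum_u tau i j u *: univ_gen s u)).
  under eq_bigr do rewrite scaler_sumr.
  rewrite exchange_big; apply: eq_bigr => s _; rewrite (bilin_sumr bt).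
  by apply: eq_bigr => u _; rewrite (bilinZr bt).
transitivity (\sum_p \sum_q \sum_s \sum_t
   tau s t a *: ((univ_gen s p * univ_gen t q) ⊗ (univ_gen p i * univ_gen q j))).
  transitivity (\sum_s \sum_p \sum_q (tau p q s *: univ_gen a s) ⊗
      (univ_gen p i * univ_gen q j)).
    apply: eq_bigr => s _; rewrite univ_gen_rel (bilin_sumr bt).
    apply: eq_bigr => p _; rewrite (bilin_sumr bt); apply: eq_bigr => q _.
    by rewrite (bilinZr bt) (bilinZl bt).
  rewrite exchange_big; apply: eq_bigr => p _.
  rewrite exchange_big; apply: eq_bigr => q _.
  rewrite -(bilin_suml bt) univ_gen_rel (bilin_suml bt); apply: eq_bigr => s _.
  by rewrite (bilin_suml bt); apply: eq_bigr => t _; rewrite (bilinZl bt).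
under eq_bigr do rewrite exchange_big /=.
rewrite exchange_big; apply: eq_bigr => s _ /=.
under eq_bigr do rewrite exchange_big /=.
rewrite exchange_big; apply: eq_bigr => t _ /=.
rewrite big_distrlr /= scaler_sumr; apply: eq_bigr => p _.
by rewrite scaler_sumr; apply: eq_bigr => q _; rewrite ptensorM.
Qed.

Lemma univ_comul_gen i j :
  univ_comul (univ_gen i j) = \sum_s univ_gen i s ⊗ univ_gen s j.
Proof. exact: (univ_eval_gen comul_hom). Qed.
Lemma univ_counit_gen i j : univ_counit (univ_gen i j) = (i == j)%:R.
Proof. exact: (univ_eval_gen delta_hom). Qed.
Lemma univ_comul_linear : linear univ_comul.
Proof. exact: (univ_eval_linear comul_hom). Qed.
Lemma univ_comul_monoid : monoid_morphism univ_comul.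
Proof. exact: (univ_eval_monoid comul_hom). Qed.
Lemma univ_counit_linear : scalar univ_counit.
Proof. exact: (univ_eval_linear delta_hom). Qed.
Lemma univ_counit_monoid : monoid_morphism univ_counit.
Proof. exact: (univ_eval_monoid delta_hom). Qed.

Let lD := univ_comul_linear.
Let mD := univ_comul_monoid.
Let lid : linear (@id univ_alg). Proof. by []. Qed.
Let mid : monoid_morphism (@id univ_alg). Proof. by []. Qed.

Lemma univ_comulA x :
  tensor_assoc (tensor_map univ_comul id (univ_comul x))
  = tensor_map id univ_comul (univ_comul x).
Proof.
have lA := @tensor_assoc_linear k univ_alg univ_alg univ_alg.
have mA := @tensor_assoc_monoid k univ_alg univ_alg univ_alg.
have lL := tensor_map_linear lD lid; have lR := tensor_map_linear lid lD.
have mL := tensor_map_monoid lD lid mD mid.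
have mR := tensor_map_monoid lid lD mid mD.
apply: (univ_hom_ext
  (f := fun x => tensor_assoc (tensor_map univ_comul id (univ_comul x)))
  (g := fun x => tensor_map id univ_comul (univ_comul x))).
- by move=> a y z; rewrite lD lL lA.
- by move=> a y z; rewrite lD lR.
- by split=> [|y z]; rewrite ?mD.1 ?mL.1 ?mA.1 // mD.2 mL.2 mA.2.
- by split=> [|y z]; rewrite ?mD.1 ?mR.1 // mD.2 mR.2.
have bt := @ptensor_bilin k univ_alg univ_alg.
have bt1 := @ptensor_bilin k univ_alg (tensor univ_alg univ_alg).
have bt2 := @ptensor_bilin k (tensor univ_alg univ_alg) univ_alg.
move=> i j; rewrite univ_comul_gen (linf_sum lL) (linf_sum lR) (linf_sum lA).
transitivity (\sum_s \sum_t univ_gen i s ⊗ (univ_gen s t ⊗ univ_gen t j)).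
  rewrite exchange_big; apply: eq_bigr => t _.
  rewrite tensor_mapE // univ_comul_gen (bilin_suml bt2) (linf_sum lA).
  by apply: eq_bigr => s _; rewrite tensor_assocE.
apply: eq_bigr => s _; rewrite tensor_mapE // univ_comul_gen.
by rewrite (bilin_sumr bt1).
Qed.

Lemma univ_counitl x :
  tensor_lift (fun a b => univ_counit a *: b) (univ_comul x) = x.
Proof.
have bl : bilin (fun a b : univ_alg => univ_counit a *: b).
  split=> [v|u] a g h; first by rewrite univ_counit_linear scalerDl scalerA.
  by rewrite scalerDr !scalerA mulrC.
have lL := tensor_lift_linear bl.
have mL : monoid_morphism (tensor_lift (fun a b : univ_alg => univ_counit a *: b)).
  apply: tensor_lift_monoid => //; first by rewrite univ_counit_monoid.1 scale1r.
  move=> y y' z z'.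
  by rewrite univ_counit_monoid.2 -scalerAl -scalerAr scalerA.
apply: (univ_hom_ext (g := id) (f := fun x =>
  tensor_lift (fun a b : univ_alg => univ_counit a *: b) (univ_comul x))) => //.
- by move=> a y z; rewrite lD lL.
- by split=> [|y z]; rewrite ?mD.1 ?mL.1 // mD.2 mL.2.
move=> i j; rewrite univ_comul_gen (linf_sum lL) (bigD1 i) //= big1 ?addr0.
  by rewrite tensor_liftE // univ_counit_gen eqxx scale1r.
move=> s /negPf si; rewrite tensor_liftE // univ_counit_gen eq_sym si.
by rewrite scale0r.
Qed.

Lemma univ_counitr x :
  tensor_lift (fun a b => univ_counit b *: a) (univ_comul x) = x.
Proof.
have bl : bilin (fun a b : univ_alg => univ_counit b *: a).
  split=> [v|u] a g h; first by rewrite scalerDr !scalerA mulrC.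
  by rewrite univ_counit_linear scalerDl scalerA.
have lL := tensor_lift_linear bl.
have mL : monoid_morphism (tensor_lift (fun a b : univ_alg => univ_counit b *: a)).
  apply: tensor_lift_monoid => //; first by rewrite univ_counit_monoid.1 scale1r.
  move=> y y' z z'.
  by rewrite univ_counit_monoid.2 -scalerAl -scalerAr scalerA.
apply: (univ_hom_ext (g := id) (f := fun x =>
  tensor_lift (fun a b : univ_alg => univ_counit b *: a) (univ_comul x))) => //.
- by move=> a y z; rewrite lD lL.
- by split=> [|y z]; rewrite ?mD.1 ?mL.1 // mD.2 mL.2.
move=> i j; rewrite univ_comul_gen (linf_sum lL) (bigD1 j) //= big1 ?addr0.
  by rewrite tensor_liftE // univ_counit_gen eqxx scale1r.
move=> s /negPf si; rewrite tensor_liftE // univ_counit_gen si.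
by rewrite scale0r.
Qed.

HB.instance Definition _ := isBialgebra.Build k univ_alg
  univ_comul_linear univ_comul_monoid univ_counit_linear univ_counit_monoid
  univ_comulA univ_counitl univ_counitr.

End UniversalAlgebra.

HB.mixin Record isLeibniz (k : fieldType) h of GRing.Lmodule k h := {
  lbracket : h -> h -> h;
  lbracket_bilin : bilin lbracket;
  lbracket_leibniz : forall x y z, lbracket x (lbracket y z)
    = lbracket (lbracket x y) z - lbracket (lbracket x z) y
}.

#[short(type="leibnizType")]
HB.structure Definition Leibniz (k : fieldType) :=
  { h of GRing.Lmodule k h & isLeibniz k h }.

#[short(type="finLeibnizType")]
HB.structure Definition FinLeibniz (k : fieldType) :=
  { h of Vector k h & isLeibniz k h }.

Section LeibnizAut.
Variables (k : fieldType) (h : finLeibnizType k).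

Definition is_leibniz_aut (f : 'End(h)) : bool :=
  `[< bijective f /\
      forall x y, f (lbracket x y) = lbracket (f x) (f y) >].

Record leibniz_aut := LeibnizAut {
  leibniz_aut_val : 'End(h);
  leibniz_aut_valP : is_leibniz_aut leibniz_aut_val
}.
HB.instance Definition _ := [isSub for leibniz_aut_val].
HB.instance Definition _ := [Choice of leibniz_aut by <:].

Lemma is_leibniz_aut1 : is_leibniz_aut \1%VF.
Proof.
apply/asboolP; split=> [|x y]; last by rewrite !id_lfunE.
by exists \1%VF => x; rewrite !id_lfunE.
Qed.

Lemma is_leibniz_autM (f g : leibniz_aut) : is_leibniz_aut (val f \o val g)%VF.
Proof.
have [/asboolP [bf hf] /asboolP [bg hg]] := (valP f, valP g).
apply/asboolP; split=> [|x y]; last by rewrite !comp_lfunE hg hf.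
by apply: (eq_bij (bij_comp bf bg)) => x; rewrite comp_lfunE.
Qed.

Lemma leibniz_aut_inj (f : leibniz_aut) : lker (val f) == 0%VS.
Proof. by have /asboolP[/bij_inj/lker0P] := valP f. Qed.

Lemma leibniz_autKV (f : leibniz_aut) : cancel (val f)^-1%VF (val f).
Proof.
have /asboolP[[g fK gK] _] := valP f => x.
by rewrite -{1}(gK x) lker0_lfunK ?leibniz_aut_inj.
Qed.

Lemma is_leibniz_autV (f : leibniz_aut) : is_leibniz_aut (val f)^-1%VF.
Proof.
have kf := leibniz_aut_inj f; have /asboolP[_ hf] := valP f.
apply/asboolP; split=> [|x y].
  by exists (val f); [apply: leibniz_autKV | apply: lker0_lfunK].
by rewrite -[RHS](lker0_lfunK kf) hf !leibniz_autKV.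
Qed.

Definition leibniz_aut_one : leibniz_aut := LeibnizAut is_leibniz_aut1.
Definition leibniz_aut_mul (f g : leibniz_aut) : leibniz_aut :=
  LeibnizAut (is_leibniz_autM f g).
Definition leibniz_aut_inv (f : leibniz_aut) : leibniz_aut :=
  LeibnizAut (is_leibniz_autV f).

Lemma leibniz_aut_mulA : associative leibniz_aut_mul.
Proof. by move=> x y z; apply: val_inj; rewrite /= comp_lfunA. Qed.
Lemma leibniz_aut_mul1 : left_id leibniz_aut_one leibniz_aut_mul.
Proof. by move=> x; apply: val_inj; rewrite /= comp_lfun1l. Qed.
Lemma leibniz_aut_mulr1 : right_id leibniz_aut_one leibniz_aut_mul.
Proof. by move=> x; apply: val_inj; rewrite /= comp_lfun1r. Qed.
Lemma leibniz_aut_mulV :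
  left_inverse leibniz_aut_one leibniz_aut_inv leibniz_aut_mul.
Proof.
move=> f; apply: val_inj; apply/lfunP => x /=.
by rewrite comp_lfunE id_lfunE lker0_lfunK ?leibniz_aut_inj.
Qed.
Lemma leibniz_aut_mulrV :
  right_inverse leibniz_aut_one leibniz_aut_inv leibniz_aut_mul.
Proof.
move=> f; apply: val_inj; apply/lfunP => x /=.
by rewrite comp_lfunE id_lfunE leibniz_autKV.
Qed.
HB.instance Definition _ := isGroup.Build leibniz_aut leibniz_aut_mulA
  leibniz_aut_mul1 leibniz_aut_mulr1 leibniz_aut_mulV leibniz_aut_mulrV.

End LeibnizAut.

Definition struct_const (k : fieldType) (h : finLeibnizType k) (n : nat)
    (e : n.-tuple h) (i j s : 'I_n) : k :=
  coord e s (lbracket e`_i e`_j).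

Definition univ_bialg (k : fieldType) (h : finLeibnizType k) (n : nat)
    (e : n.-tuple h) : bialgType k :=
  univ_alg (struct_const e).

(* Main.v *)
Require Import Defs.
From HB Require Import structures.
From mathcomp Require Import all_boot all_algebra.
From mathcomp Require Import boolp.

Set Implicit Arguments.
Unset Strict Implicit.
Unset Printing Implicit Defensive.

Import GRing.Theory.
Local Open Scope ring_scope.

(** An endomorphism f of h preserves the bracket exactly when its matrix in
    the basis e satisfies the defining relations of A(h), i.e. when it is the
    matrix of values on the x_ij of an algebra morphism A(h) -> k. Since the
    comultiplication of A(h) is dual to the matrix product, convolution of
    such morphisms is composition of endomorphisms; so the monoid G(A(h)°) is
    isomorphic to that of Leibniz endomorphisms of h, and the claim follows by
    passing to invertible elements. *)

Section BasisMatrix.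
Variables (k : fieldType) (h : finLeibnizType k) (n : nat) (e : n.-tuple h).
Hypothesis he : basis_of fullv e.

Let bb : bilin (@lbracket k h) := @lbracket_bilin k h.

Lemma basis_coord_sum (x : h) : x = \sum_(i < n) coord e i x *: e`_i.
Proof. exact: (coord_basis he (memvf x)). Qed.

Lemma coord_basis_sum (c : 'I_n -> k) a : coord e a (\sum_i c i *: e`_i) = c a.
Proof. exact/coord_sum_free/(basis_free he). Qed.

(** Column convention: column [i] of [m] lists the coordinates of the image of [e_i], matching the
    order of the indices in [x_si]. *)
Definition end_of_mx (m : 'I_n -> 'I_n -> k) : 'End(h) :=
  \sum_i linfun (fun x => coord e i x *: \sum_s m s i *: e`_s).

Lemma end_of_mxE m (i : 'I_n) : end_of_mx m e`_i = \sum_s m s i *: e`_s.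
Proof.
have l j : linear (fun x => coord e j x *: \sum_s m s j *: e`_s).
  by move=> a x y; rewrite linearP scalerDl scalerA.
(* [lfunE] evaluates [linfun] only on a bundled linear map, so each summand is packed with its
   linearity proof. *)
pose L j : {linear h -> h} := HB.pack (fun x => coord e j x *: \sum_s m s j *: e`_s)
  (GRing.isLinear.Build _ _ _ _ _ (l j)).
have LE j x : linfun (fun x => coord e j x *: \sum_s m s j *: e`_s) x
    = coord e j x *: \sum_s m s j *: e`_s := lfunE (L j) x.
rewrite sum_lfunE [LHS](bigD1 i) //= [X in _ + X]big1 ?addr0 => [|j ji].
  by rewrite LE coord_free ?(basis_free he) // eqxx scale1r.
rewrite LE coord_free ?(basis_free he) //.
by rewrite eq_sym (negPf ji) scale0r.
Qed.

Lemma end_basis_ext (f g : 'End(h)) :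
  (forall i : 'I_n, f e`_i = g e`_i) -> f = g.
Proof.
move=> fg; apply/lfunP => x; rewrite (basis_coord_sum x) !linear_sum.
by apply: eq_bigr => i _; rewrite !linearZ /= fg.
Qed.

Definition leibniz_end (f : 'End(h)) : Prop :=
  forall x y, f (lbracket x y) = lbracket (f x) (f y).

Lemma leibniz_end_basis (f : 'End(h)) :
  (forall i j : 'I_n, f (lbracket e`_i e`_j) = lbracket (f e`_i) (f e`_j)) ->
  leibniz_end f.
Proof.
move=> H x y; rewrite (basis_coord_sum x) (basis_coord_sum y).
rewrite !linear_sum !(bilin_suml bb) linear_sum; apply: eq_bigr => i _.
rewrite !(bilin_sumr bb) linear_sum; apply: eq_bigr => j _.
by rewrite (bilinZl bb) (bilinZr bb) !linearZ /= (bilinZl bb) (bilinZr bb) H.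
Qed.

(** By bilinearity it is enough to test pairs [e_i], [e_j]; the [e_a]-coordinates of the two sides
    of the test are the two sides of the relation indexed by [a], [i], [j]. *)
Lemma leibniz_end_of_mxP (m : 'I_n -> 'I_n -> k) :
  leibniz_end (end_of_mx m) <->
  forall a i j, \sum_u struct_const e i j u * m a u
    = \sum_s \sum_t struct_const e s t a * (m s i * m t j).
Proof.
have EL (i j a : 'I_n) : coord e a (end_of_mx m (lbracket e`_i e`_j))
    = \sum_u struct_const e i j u * m a u.
  rewrite (basis_coord_sum (lbracket e`_i e`_j)) !linear_sum.
  by apply: eq_bigr => u _; rewrite !linearZ /= end_of_mxE coord_basis_sum.
have ER (i j a : 'I_n) : coord e a (lbracket (end_of_mx m e`_i) (end_of_mx m e`_j))
    = \sum_s \sum_t struct_const e s t a * (m s i * m t j).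
  rewrite !end_of_mxE (bilin_suml bb) linear_sum; apply: eq_bigr => s _.
  rewrite (bilin_sumr bb) linear_sum; apply: eq_bigr => t _.
  by rewrite (bilinZl bb) (bilinZr bb) !linearZ /= mulrA mulrC.
split=> [H a i j|H]; first by rewrite -EL H ER.
apply: leibniz_end_basis => i j; rewrite [LHS]basis_coord_sum [RHS]basis_coord_sum.
by apply: eq_bigr => a _; rewrite EL ER H.
Qed.

Local Notation A := (univ_bialg e).
Local Notation x_ := (univ_gen (struct_const e)).
Local Notation G := (grouplike (finite_dual A)).

Definition gl_end (g : G) : 'End(h) := end_of_mx (fun s i => val g (x_ s i)).

Lemma gl_endE g (i : 'I_n) : gl_end g e`_i = \sum_s val g (x_ s i) *: e`_s.
Proof. exact: end_of_mxE. Qed.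

Lemma gl_monoid (g : G) : monoid_morphism (val g : A -> k).
Proof. exact/fdual_grouplikeP/(valP g). Qed.

(** A group-like element is an algebra morphism to [k], so it carries the relations among the [x_ij]
    to relations among their values. *)
Lemma gl_end_leibniz g : leibniz_end (gl_end g).
Proof.
apply/leibniz_end_of_mxP => a i j.
have l := fdual_lin (val g); have m := gl_monoid g.
have := congr1 (val g : A -> k) (univ_gen_rel (struct_const e) a i j).
rewrite !(linf_sum l) => E.
transitivity (\sum_u val g (struct_const e i j u *: x_ a u)).
  by apply: eq_bigr => u _; rewrite (linfZ l).
rewrite E; apply: eq_bigr => s _; rewrite (linf_sum l).
by apply: eq_bigr => t _; rewrite (linfZ l) m.2.
Qed.

(** The [x_ij] generate the algebra, and the values of [g] on them are the matrix entries of
    [gl_end g]. *)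
Lemma gl_end_inj : injective gl_end.
Proof.
move=> g g' E; apply/val_inj/fdualP.
apply: (univ_hom_ext (S := k^o) (fdual_lin _) (fdual_lin _)
  (gl_monoid g) (gl_monoid g')) => s i.
have /(congr1 (fun f : 'End(h) => coord e s (f e`_i))) := E.
by rewrite !gl_endE !coord_basis_sum.
Qed.

(** The matrix of [f] satisfies the defining relations, so evaluation at it descends to the quotient
    algebra. *)
Lemma gl_end_surj f : leibniz_end f -> exists g, gl_end g = f.
Proof.
pose m s i : k^o := coord e s (f e`_i).
have fm : f = end_of_mx m.
  by apply: end_basis_ext => i; rewrite end_of_mxE -basis_coord_sum.
rewrite fm => /leibniz_end_of_mxP hm.
have l : scalar (univ_eval m : A -> k) := univ_eval_linear (S := k^o) hm.
have mm : monoid_morphism (univ_eval m : A -> k) :=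
  univ_eval_monoid (S := k^o) hm.
(* The kernel of an algebra morphism to [k] is an ideal of finite codimension. *)
pose v : finite_dual A := FiniteDual l (alg_hom_cofinite l mm).
exists (Grouplike ((fdual_grouplikeP v).2 mm)).
apply: end_basis_ext => i; rewrite gl_endE end_of_mxE.
by apply: eq_bigr => s _ /=; rewrite (univ_eval_gen (S := k^o) hm).
Qed.

Lemma gl_end1 : gl_end 1%g = \1%VF.
Proof.
apply: end_basis_ext => i; rewrite gl_endE id_lfunE.
rewrite (bigD1 i) //= big1 ?addr0 => [|s /negPf si].
  by rewrite [counit _]univ_counit_gen eqxx scale1r.
by rewrite [counit _]univ_counit_gen si scale0r.
Qed.

Lemma gl_endM g g' : gl_end (g * g')%g = (gl_end g \o gl_end g')%VF.
Proof.
apply: end_basis_ext => i; rewrite comp_lfunE !gl_endE linear_sum.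
under [RHS]eq_bigr do rewrite linearZ /= gl_endE scaler_sumr.
rewrite exchange_big; apply: eq_bigr => s _ /=.
have -> : convolution (val g) (val g') (x_ s i)
    = \sum_r val g (x_ s r) * val g' (x_ r i).
  (* The list spells out the comultiplication of [x_si] as the sum of the pure tensors of [x_sr] and
     [x_ri], whence the matrix product. *)
  rewrite (@convolutionE k A _ _ _ [seq (x_ s r, x_ r i) | r <- enum 'I_n]).
    by rewrite big_map big_enum.
  by rewrite big_map big_enum [comul _]univ_comul_gen.
by rewrite scaler_suml; apply: eq_bigr => r _; rewrite scalerA mulrC.
Qed.

Lemma gl_end_aut (g : units G) : is_leibniz_aut (gl_end (val g)).
Proof.
have /asboolP[g' [gg' g'g]] := valP g.
apply/asboolP; split; last exact: gl_end_leibniz.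
by exists (gl_end g') => x;
  rewrite -comp_lfunE -gl_endM ?g'g ?gg' gl_end1 id_lfunE.
Qed.

(** Both [f] and its inverse have preimages under [gl_end]; injectivity makes these preimages
    mutually inverse. *)
Lemma gl_end_unit (f : leibniz_aut h) :
  exists g : units G, gl_end (val g) = val f.
Proof.
have leib (f' : leibniz_aut h) : leibniz_end (val f').
  by have /asboolP[] := valP f'.
have [[g Eg] [g' Eg']] := (gl_end_surj (leib f), gl_end_surj (leib f^-1%g)).
have ginv : is_invertible g.
  apply/asboolP; exists g'.
  split; apply: gl_end_inj; rewrite gl_endM Eg Eg' gl_end1.
    by rewrite -[LHS]/(val (f * f^-1)%g) mulgV.
  by rewrite -[LHS]/(val (f^-1 * f)%g) mulVg.
by exists (Units ginv).
Qed.

End BasisMatrix.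

Theorem theorem3p1 (k : fieldType) (h : finLeibnizType k) (n : nat)
    (e : n.-tuple h) (he : basis_of fullv e) :
  exists gamma : units (grouplike (finite_dual (univ_bialg e))) -> leibniz_aut h,
    [/\ forall theta (i : 'I_n),
          val (gamma theta) e`_i
          = \sum_(s < n) val (val theta) (univ_gen (struct_const e) s i) *: e`_s,
        {morph gamma : theta theta' / (theta * theta')%g},
        gamma 1%g = 1%g
      & bijective gamma].
Proof.
exists (fun theta => LeibnizAut (gl_end_aut he theta)); split.
- by move=> theta i; rewrite /= gl_endE.
- by move=> theta theta'; apply: val_inj; apply: gl_endM.
- by apply: val_inj; apply: gl_end1.
(* The inverse map picks a preimage of each automorphism; injectivity of [gl_end] makes it a left
   inverse too. *)
have [inv invE] := choice (gl_end_unit he).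
exists inv => [theta|f]; last by apply: val_inj; rewrite /= invE.
by apply/val_inj/(gl_end_inj he); rewrite invE.
Qed.
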